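(* Let $\phi\in H^s(\mathbb{R}^3)$ with $s\ge0$ and let $k\in\mathbb{N}$. For $\epsilon>0$ let $\mathcal{S}_\epsilon\phi=m_\epsilon*\phi$. Then: (i) (Boundedness) $\|\mathcal{S}_\epsilon\phi\|_{H^s(\mathbb{R}^3)}\le\|\phi\|_{H^s(\mathbb{R}^3)}$. (ii) (Approximation) $\lim_{\epsilon\to0}\|\mathcal{S}_\epsilon\phi-\phi\|_{H^s(\mathbb{R}^3)}=0$. (iii) (Smoothing effect) There exists $C_{2k}>0$, independent of $\epsilon$ and $\phi$, such that \[ \|\mathcal{S}_\epsilon\phi\|_{H^{s+2k}(\mathbb{R}^3)}\le C_{2k}\,\epsilon^{-2k}\,\|\phi\|_{H^s(\mathbb{R}^3)} . \] Hence $\mathcal{S}_\epsilon\phi\in C^\infty(\mathbb{R}^3)$ for every fixed $\epsilon>0$.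
   Context: $m\in C_c^\infty(\mathbb{R}^3)$ is nonnegative with $\int_{\mathbb{R}^3}m=1$, $m_\epsilon(x)=\epsilon^{-3}m(x/\epsilon)$, and $(m_\epsilon*\phi)(x)=\int_{\mathbb{R}^3}m_\epsilon(x-y)\phi(y)\,dy$.
   Formalization: In (iii) the bound is proved for 0 < ε ≤ ε₀ with ε₀ > 0 arbitrary and C_{2k} depending on ε₀ (not on ε, φ, s), because a single constant for all ε > 0 fails when k ≥ 1: take the Fourier transform of φ supported in |ξ| < δ/ε and let ε → ∞. *)

(* Defs.v *)
From HB Require Import structures.
From mathcomp Require Import all_boot all_order all_algebra.
From mathcomp Require Import complex.
From mathcomp Require Import all_classical all_reals all_analysis.

Set Implicit Arguments.
Unset Strict Implicit.
Unset Printing Implicit Defensive.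

Import Order.TTheory GRing.Theory Num.Theory.
Import numFieldNormedType.Exports.

Local Open Scope classical_set_scope.
Local Open Scope ring_scope.
Local Open Scope complex_scope.

(* The norm of the product R * R * R is the max norm, which only matters for
   the topology; Euclidean lengths are always written with [dot]. *)
Notation R3 R := (R * R * R)%type.

(* The library's sigma-finiteness of products is not found by inference when
   the factors are not subprobabilities. *)
Lemma product_sigma_finite d1 d2 (T1 : measurableType d1)
    (T2 : measurableType d2) (R : realType)
    (m1 : {sigma_finite_measure set T1 -> \bar R})
    (m2 : {sigma_finite_measure set T2 -> \bar R}) :
  sigma_finite setT (m1 \x m2)%E.
Proof.
have /sigma_finiteP[F [TF ndF Foo]] := sigma_finiteT m1.
have /sigma_finiteP[G [TG ndG Goo]] := sigma_finiteT m2.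
exists (fun n => F n `*` G n).
  rewrite -setXTT TF TG predeqE => -[x y]; split.
    move=> [/= [n _ Fnx] [k _ Gky]]; exists (maxn n k) => //; split.
    - by move: x Fnx; exact/subsetPset/ndF/leq_maxl.
    - by move: y Gky; exact/subsetPset/ndG/leq_maxr.
  by move=> [n _ []/= ? ?]; split; exists n.
move=> k; have [? ?] := Foo k; have [? ?] := Goo k.
split; first exact: measurableX.
by rewrite product_measure1E// lte_mul_pinfty// ge0_fin_numE.
Qed.

Section Lebesgue.
Variable R : realType.
Local Notation M := (measurableTypeR R).

Definition leb2 : set (M * M) -> \bar R :=
  (lebesgue_measure \x lebesgue_measure)%E.
HB.instance Definition _ := Measure.on leb2.
HB.instance Definition _ :=
  Measure_isSigmaFinite.Build _ _ _ leb2 (product_sigma_finite _ _).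

Definition leb3 : set (M * M * M) -> \bar R := (leb2 \x lebesgue_measure)%E.
HB.instance Definition _ := Measure.on leb3.
HB.instance Definition _ :=
  Measure_isSigmaFinite.Build _ _ _ leb3 (product_sigma_finite _ _).

End Lebesgue.
Arguments leb2 R : clear implicits.
Arguments leb3 R : clear implicits.

Section Space.
Variable R : realType.

Definition basis (i : 'I_3) : R3 R :=
  ((i == 0%N :> nat)%:R, (i == 1%N :> nat)%:R, (i == 2%N :> nat)%:R).

Definition dot (x y : R3 R) : R := x.1.1 * y.1.1 + x.1.2 * y.1.2 + x.2 * y.2.

(* <x>^2 = 1 + |x|^2 *)
Definition japanese2 (x : R3 R) : R := 1 + dot x x.

Definition partial (i : 'I_3) (f : R3 R -> R) : R3 R -> R :=
  fun x => 'D_(basis i) f x.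

Definition iter_partial (l : seq 'I_3) (f : R3 R -> R) : R3 R -> R :=
  foldr partial f l.

Definition smooth (f : R3 R -> R) : Prop :=
  forall l : seq 'I_3, continuous (iter_partial l f) /\
    forall (i : 'I_3) (x : R3 R), derivable (iter_partial l f) x (basis i).

Definition smooth_compact_support (f : R3 R -> R) : Prop :=
  smooth f /\ compact (closure [set x | f x != 0]).

Definition schwartz (f : R3 R -> R) : Prop :=
  smooth f /\
  forall (l : seq 'I_3) (N : nat), exists C : R,
    forall x, japanese2 x ^+ N * `|iter_partial l f x| <= C.

End Space.

Section ComplexValued.
Variable R : realType.
Implicit Types (f g phi psi : R3 R -> R[i]) (s : R).

Definition reF f : R3 R -> R := fun x => complex.Re (f x).
Definition imF f : R3 R -> R := fun x => complex.Im (f x).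

Definition csmooth f : Prop := smooth (reF f) /\ smooth (imF f).
Definition cschwartz f : Prop := schwartz (reF f) /\ schwartz (imF f).

Definition cL2 f : Prop :=
  reF f \in Lfun (leb3 R) 2%:E /\ imF f \in Lfun (leb3 R) 2%:E.

Definition cintegral f : R[i] :=
  (\int[leb3 R]_x reF f x) +i* (\int[leb3 R]_x imF f x).

Definition expi (t : R) : R[i] := cos t +i* sin t.

(* Unitary normalisation, so that the H^0 norm is the L^2 norm. *)
Definition fourier_integral f : R3 R -> R[i] := fun xi =>
  ((2 * pi) `^ (- (3 / 2)))%:C * cintegral (fun x => expi (- dot x xi) * f x).

(* g is the Fourier transform of phi in the sense of tempered distributions:
   <g, psi> = <phi, F psi> for every Schwartz function psi.  Such a g is unique
   up to null sets; the Fourier transform of an L^2 function is in L^2. *)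
Definition is_fourier phi g : Prop :=
  cL2 g /\
  forall psi, cschwartz psi ->
    cintegral (fun xi => g xi * psi xi) =
    cintegral (fun x => phi x * fourier_integral psi x).

(* A representative of the Fourier transform (0 if there is none, which does
   not happen for phi in L^2). *)
Definition fourier phi : R3 R -> R[i] := xget (fun=> 0) [set g | is_fourier phi g].

(* || <xi>^s g ||_{L^2} *)
Definition weighted_norm s g : \bar R :=
  Lnorm (leb3 R) 2%:E (fun xi => (japanese2 xi `^ (s / 2) * Normc.normc (g xi))%:E).

Definition sobolev_norm s phi : \bar R := weighted_norm s (fourier phi).

(* H^s for s >= 0, as a subspace of L^2. *)
Definition sobolev s phi : Prop :=
  cL2 phi /\ exists2 g, is_fourier phi g & (weighted_norm s g < +oo)%E.

(* m_eps(x) = eps^{-3} m(x / eps) *)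
Definition rescale (m : R3 R -> R) (eps : R) : R3 R -> R :=
  fun x => eps ^- 3 * m (eps^-1 *: x).

(* S_eps phi = m_eps * phi *)
Definition mollify (m : R3 R -> R) (eps : R) phi : R3 R -> R[i] :=
  fun x => cintegral (fun y => (rescale m eps (x - y))%:C * phi y).

End ComplexValued.

(* Main.v *)
(* Convolution with a Schwartz kernel M multiplies the Fourier transform, in the
   weak sense, by Mhat(xi) = int M(z) e^(-i z.xi) dz: for a Schwartz function psi,
   F(Mhat psi)(x) is the average of F psi(x + z) against M(z) dz, and Fubini moves
   this average onto phi.  For M = m_eps, Mhat(xi) = mhat(eps xi), where
   |mhat| <= 1 = mhat(0) because m is nonnegative of integral 1, and mhat decays
   faster than every polynomial; these three facts give boundedness,
   approximation (by dominated convergence) and smoothing.  Smoothness of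
   m_eps * phi is differentiation under the integral sign.

   The Sobolev norm does not depend on the chosen Fourier transform: if an L^2
   function h vanishes against all Schwartz functions, then m_eps * h = 0 for
   every eps, and letting eps tend to 0, h vanishes against all continuous
   functions of sufficient decay, hence almost everywhere. *)

Require Import Defs.
From HB Require Import structures.
From mathcomp Require Import all_boot all_order all_algebra.
From mathcomp Require Import complex.
From mathcomp Require Import all_classical all_reals all_analysis.
From mathcomp Require Import measurable_realfun.
From mathcomp Require Import ring lra.

Set Implicit Arguments.
Unset Strict Implicit.
Unset Printing Implicit Defensive.

Import Order.TTheory GRing.Theory Num.Theory.
Import numFieldNormedType.Exports.

Local Open Scope classical_set_scope.
Local Open Scope ring_scope.

(** Sobolev norms live on the Fourier side, where the three estimates become pointwise statements
    about the multiplier. The one fact needed on the space side, that m_eps * phi is again in L^2,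
    comes from Jensen's inequality and Tonelli's theorem. The duality argument asks of
    [fourier_integral psi] only decay, which repeated integration by parts provides.

    Complex integrals are split into real cosine transforms carrying a phase, so that one real lemma
    serves both components.

    The exponents come from Peetre's inequality. With J = 1 + |x|^2 the weight J^(-3) is integrable
    on R^3; transferring it from y - x to x costs J(y)^3, so the functions that are averaged are
    asked to decay like J^(-6).

    In the smoothing estimate eps stays below some eps0, on which the constant depends: Mhat equals
    1 at frequency 0 for every eps, so for k > 0 no bound C eps^(-2k) can hold for all eps > 0. *)

Local Notation mR R := (measurableTypeR R).
Local Notation mR3 R := (mR R * mR R * mR R)%type.

(** * Integration on R^3 *)

Section MeasurableSpace.
Variable R : realType.

(** Second countability: an open set is the union of the boxes with rational centre and radius
    [n.+1%:R^-1] that it contains, and each box lies in the product sigma-algebra. *)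
Lemma measurable_open3 (U : set (R3 R)) :
  open U -> measurable (U : set (mR3 R)).
Proof.
move=> oU.
pose box (q : rat * rat * rat * nat) : set (mR3 R) :=
  [set x | `|ratr q.1.1.1 - x.1.1| < q.2.+1%:R^-1] `&`
  [set x | `|ratr q.1.1.2 - x.1.2| < q.2.+1%:R^-1] `&`
  [set x | `|ratr q.1.2 - x.2| < q.2.+1%:R^-1].
have mabs (f : mR3 R -> R) (c e : R) : measurable_fun setT f ->
    measurable [set x | `|c - f x| < e].
  move=> mf; rewrite [X in measurable X](_ : _ =
    setT `&` (fun x => `|c - f x|) @^-1` `]-oo, e[); last first.
    by rewrite setTI; apply/seteqP; split => x /=; rewrite in_itv.
  have mg : measurable_fun setT (fun x => `|c - f x|).
    by apply: measurableT_comp => //; exact: measurable_funB.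
  exact: mg.
have mbox q : measurable (box q).
  apply: measurableI; first apply: measurableI.
  - by apply: mabs; exact: measurableT_comp measurable_fst measurable_fst.
  - by apply: mabs; exact: measurableT_comp measurable_snd measurable_fst.
  - by apply: mabs; exact: measurable_snd.
have -> : U = \bigcup_(q in [set q | box q `<=` U]) box q.
  apply/seteqP; split; last by move=> x [q /= qU qx]; exact: qU.
  move=> x Ux; have /nbhs_ballP[e /= e0 eU] : nbhs x U by exact: open_nbhs_nbhs.
  (* The radius is below [e / 2] because [x] and [y] are compared through the centre of the box. *)
  have [n _ /(_ n (leqnn _)) /=] :=
    near_infty_natSinv_lt (PosNum (divr_gt0 e0 (ltr0n _ 2))).
  rewrite /= => ne.
  have rp (a : R) : exists q : rat, `|ratr q - a| < n.+1%:R^-1.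
    have /rat_in_itvoo[q] : a < a + n.+1%:R^-1 by rewrite ltrDl.
    rewrite in_itv/= => /andP[aq qa]; exists q.
    by rewrite ger0_norm ?subr_ge0 ?ltW// ltrBlDl.
  have [q1 q1x] := rp x.1.1; have [q2 q2x] := rp x.1.2.
  have [q3 q3x] := rp x.2.
  exists (q1, q2, q3, n); last by [].
  move=> y [[/= y1 y2] y3]; apply: eU.
  have tri (q a b : R) : `|q - a| < n.+1%:R^-1 -> `|q - b| < n.+1%:R^-1 ->
     `|a - b| < e.
    move=> qa qb; rewrite (_ : a - b = (a - q) + (q - b)); last by ring.
    rewrite (le_lt_trans (ler_normD _ _))// distrC.
    by rewrite (splitr e) ltrD// (lt_trans _ ne).
  by split; first split; apply: tri; [exact: q1x|exact: y1|exact: q2x|exact: y2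
    |exact: q3x|exact: y3].
rewrite bigcup_mkcond; apply: countable_bigcupT_measurable => // q.
by case: ifP => _; [exact: mbox | exact: measurable0].
Qed.

Lemma measurable_fun_continuous3 (f : R3 R -> R) :
  continuous f -> measurable_fun [set: mR3 R] f.
Proof.
move=> /continuousP cf.
apply: (measurability _ (RGenOInfty.measurableE R)).
move=> _ [_ [a ->] <-]; rewrite setTI.
by apply: measurable_open3; apply: cf; exact: interval_open.
Qed.

(** A change of variables stated for nonnegative functions rather than for sets, so that Tonelli's
    theorem carries it from the factors to the product. *)
Definition scales d (T : measurableType d) (mu : {measure set T -> \bar R})
    (t : T -> T) (k : R) :=
  measurable_fun setT t /\
  forall f : T -> \bar R, measurable_fun setT f -> (forall x, 0 <= f x)%E ->
    (\int[mu]_x f (t x) = k%:E * \int[mu]_x f x)%E.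

Lemma scales_prod d1 d2 (T1 : measurableType d1) (T2 : measurableType d2)
    (m1 : {sigma_finite_measure set T1 -> \bar R})
    (m2 : {sigma_finite_measure set T2 -> \bar R}) t1 t2 k1 k2 :
  0 <= k1 -> 0 <= k2 -> scales m1 t1 k1 -> scales m2 t2 k2 ->
  scales (m1 \x m2)%E (fun x => (t1 x.1, t2 x.2)) (k1 * k2).
Proof.
move=> k10 k20 [mt1 st1] [mt2 st2]; split.
  apply: measurable_fun_pair; first exact: measurableT_comp measurable_fst.
  exact: measurableT_comp measurable_snd.
move=> f mf f0.
have mt : measurable_fun setT (fun x : T1 * T2 => (t1 x.1, t2 x.2)).
  apply: measurable_fun_pair; first exact: measurableT_comp measurable_fst.
  exact: measurableT_comp measurable_snd.
rewrite fubini_tonelli1//; last exact: measurableT_comp mf mt.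
rewrite /fubini_F /=.
transitivity (\int[m1]_x (k2%:E * fubini_F m2 f (t1 x)))%E.
  apply: eq_integral => x _; apply: (st2 (fun y => f (t1 x, y))) => //.
  by apply: measurableT_comp mf _; exact: measurable_fun_pair.
have mF := measurable_fun_fubini_tonelli_F (m2 := m2) f mf f0.
rewrite (st1 (fun x => k2%:E * fubini_F m2 f x)%E); last 2 first.
- by apply: measurable_funeM.
- by move=> x; apply: mule_ge0; [rewrite lee_fin|exact: integral_ge0].
rewrite ge0_integralZl_EFin//; last by move=> x _; exact: integral_ge0.
by rewrite muleA -EFinM fubini_tonelli1.
Qed.

(** Uniqueness of Lebesgue measure: [|c|] times its image under the affine map has the right value
    on half-open intervals. *)
Lemma scales_lebesgue (c a : R) : c != 0 ->
  scales (@lebesgue_measure R) (fun x => c * x + a) `|c|^-1.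
Proof.
move=> c0.
have mt : measurable_fun [set: mR R] (fun x : mR R => (c * x + a) : mR R).
  by apply: measurable_funD => //; exact: measurable_funM.
split=> [//|f mf f0].
pose k : {nonneg R} := NngNum (normr_ge0 c).
(* The measure structure of a pushforward takes [mt] as an argument, so it has
   to be given by name. *)
pose mu : {measure set (mR R) -> \bar R} :=
  mscale k (measure_function_pushforward__canonical__measure_function_Measure
    lebesgue_measure mt).
have muE A : measurable A -> lebesgue_measure A = mu A.
  move=> mA; apply: lebesgue_measure_unique => // _ [[x y] _ <-] /=.
  rewrite /mu/= /mscale/= /pushforward.
  have [cp|cn|/eqP] := ltgtP c 0; last by rewrite (negPf c0).
  (* Here [c] is negative, so the preimage of an interval open on the left is open on the right. *)
  - rewrite [X in (_ * lebesgue_measure X)%E](_ : _ =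
        `[(y - a) / c, (x - a) / c[%classic); last first.
      apply/seteqP; split => z /=; rewrite !in_itv/=;
        by rewrite ler_ndivrMr// ltr_ndivlMr// lerBrDr ltrBlDr mulrC andbC.
    rewrite !lebesgue_measure_itv/= !lte_fin ltr_ndivlMr// divfK// ltrD2r.
    case: ifPn => _; last by rewrite mule0.
    by rewrite -!EFinB -EFinM ltr0_norm//; congr EFin; field.
  - rewrite [X in (_ * lebesgue_measure X)%E](_ : _ =
        `](x - a) / c, (y - a) / c]%classic); last first.
      apply/seteqP; split => z /=; rewrite !in_itv/=;
        by rewrite ltr_pdivrMr// ler_pdivlMr// lerBrDr ltrBlDr mulrC.
    rewrite !lebesgue_measure_itv/= !lte_fin ltr_pdivrMr// divfK// ltrD2r.
    case: ifPn => _; last by rewrite mule0.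
    by rewrite -!EFinB -EFinM gtr0_norm//; congr EFin; field.
rewrite [X in (_ * X)%E](eq_measure_integral mu); last by move=> A mA _; exact: muE.
rewrite ge0_integral_mscale//= ge0_integral_pushforward//.
by rewrite muleA -EFinM mulVf ?normr_eq0// mul1e.
Qed.

Lemma scales_leb3 (c : R) (a : R3 R) : c != 0 ->
  scales (leb3 R) (fun x : R3 R => c *: x + a) (`|c| ^- 3).
Proof.
move=> c0; have k0 : 0 <= `|c|^-1 by rewrite invr_ge0.
have -> : `|c| ^- 3 = `|c|^-1 * `|c|^-1 * `|c|^-1.
  by field; rewrite normr_eq0.
have s1 (b : R) := scales_lebesgue b c0.
have s2 := scales_prod k0 k0 (s1 a.1.1) (s1 a.1.2).
exact: (@scales_prod _ _ _ _ (leb2 R) lebesgue_measure _ _ _ _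
  (mulr_ge0 k0 k0) k0 s2 (s1 a.2)).
Qed.

Lemma measurable_fun_affine3 (c : R) (a : R3 R) : c != 0 ->
  measurable_fun [set: mR3 R] (fun x : mR3 R => (c *: (x : R3 R) + a) : mR3 R).
Proof. by move=> /(scales_leb3 a)[]. Qed.

Lemma integrable_affine3 (c : R) (a : R3 R) (f : R3 R -> R) : c != 0 ->
  (leb3 R).-integrable setT (EFin \o f) ->
  (leb3 R).-integrable setT (EFin \o (fun x => f (c *: x + a))).
Proof.
move=> c0 /integrableP[mf foo]; have [mt st] := scales_leb3 a c0.
apply/integrableP; split; first exact: measurableT_comp mf mt.
rewrite (st (fun x => `|(f x)%:E|%E)) => //; last exact: measurableT_comp mf.
by rewrite lte_mul_pinfty// lee_fin invr_ge0 exprn_ge0.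
Qed.

Lemma Rintegral_affine3 (c : R) (a : R3 R) (f : R3 R -> R) : c != 0 ->
  (leb3 R).-integrable setT (EFin \o f) ->
  \int[leb3 R]_x f (c *: x + a) = `|c| ^- 3 * \int[leb3 R]_x f x.
Proof.
move=> c0 intf; have [mt st] := scales_leb3 a c0.
have mf : measurable_fun [set: mR3 R] (EFin \o f) by exact: measurable_int intf.
have pf : (\int[leb3 R]_x (EFin \o f)^\+ x \is a fin_num)%E.
  by apply: integrable_fin_num => //; exact: integrable_funepos.
have nf : (\int[leb3 R]_x (EFin \o f)^\- x \is a fin_num)%E.
  by apply: integrable_fin_num => //; exact: integrable_funeneg.
have stp := st _ (measurable_funepos mf) (funepos_ge0 _).
have stn := st _ (measurable_funeneg mf) (funeneg_ge0 _).
rewrite /Rintegral [X in fine X = _]integralE [X in _ = _ * fine X]integralE.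
transitivity (fine (((`|c| ^- 3)%:E * \int[leb3 R]_x (EFin \o f)^\+ x) -
    ((`|c| ^- 3)%:E * \int[leb3 R]_x (EFin \o f)^\- x))%E).
  rewrite -stp -stn; congr fine; congr (_ - _)%E; apply: eq_integral => x _.
    by rewrite !funeposE.
  by rewrite !funenegE.
by rewrite -muleBr ?fin_num_adde_defr// fineM// fin_numB pf.
Qed.

End MeasurableSpace.

(** * Integrable real-valued functions and Fubini's theorem *)

Local Notation Int mu f := (mu.-integrable setT (EFin \o f)).

Section RealIntegrals.
Context d (T : measurableType d) (R : realType).
Variable mu : {measure set T -> \bar R}.
Implicit Types f g : T -> R.

Lemma Int_measurable f : Int mu f -> measurable_fun setT f.
Proof. by move=> /measurable_int /measurable_EFinP. Qed.

Lemma Int_le g f : measurable_fun setT f -> Int mu g ->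
  (forall x, `|f x| <= g x) -> Int mu f.
Proof.
move=> mf ig fg; apply: le_integrable ig => //; first exact/measurable_EFinP.
by move=> x _ /=; rewrite lee_fin (le_trans (fg x))// ler_norm.
Qed.

Lemma IntD f g : Int mu f -> Int mu g -> Int mu (fun x => f x + g x).
Proof. by move=> If Ig; exact: (integrableD _ If Ig). Qed.

Lemma IntB f g : Int mu f -> Int mu g -> Int mu (fun x => f x - g x).
Proof. by move=> If Ig; exact: (integrableB _ If Ig). Qed.

Lemma IntZ c f : Int mu f -> Int mu (fun x => c * f x).
Proof. by move=> If; exact: (integrableZl _ c If). Qed.

Lemma Int_norm f : Int mu f -> Int mu (fun x => `|f x|).
Proof. by move=> If; exact: (integrable_norm If). Qed.

Lemma RintegralN f : Int mu f ->
  \int[mu]_x (- f x) = - \int[mu]_x f x.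
Proof.
move=> If; rewrite -mulN1r -RintegralZl//.
by apply: eq_Rintegral => x _; rewrite mulN1r.
Qed.

End RealIntegrals.

Section Tensor.
Context d1 d2 (T1 : measurableType d1) (T2 : measurableType d2) (R : realType).
Variables (m1 : {sigma_finite_measure set T1 -> \bar R})
  (m2 : {sigma_finite_measure set T2 -> \bar R}).

Lemma Int_tensor (a : T1 -> R) (b : T2 -> R) : Int m1 a -> Int m2 b ->
  Int (m1 \x m2)%E (fun z => a z.1 * b z.2).
Proof.
move=> Ia Ib; apply/integrable12ltyP.
  apply/measurable_EFinP; apply: measurable_funM.
    exact: measurableT_comp (Int_measurable Ia) measurable_fst.
  exact: measurableT_comp (Int_measurable Ib) measurable_snd.
have mb : measurable_fun setT (fun y => `|(b y)%:E|%E).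
  by apply: measurableT_comp => //; exact: measurable_int Ib.
have /integrableP[_ /=] := Ib; have /integrableP[_ /=] := Ia.
set B := (\int[m2]_y _)%E; set A := (\int[m1]_x _)%E => Aoo Boo.
have B0 : (0 <= B)%E by exact: integral_ge0.
rewrite (eq_integral (fun x => `|(a x)%:E| * B)%E); last first.
  move=> x _; rewrite -ge0_integralZl//; apply: eq_integral => y _.
  by rewrite normrM EFinM.
rewrite ge0_integralZr//; last first.
  by apply: measurableT_comp => //; exact: measurable_int Ia.
by apply: lte_mul_pinfty => //; [exact: integral_ge0|rewrite ge0_fin_numE// integral_ge0].
Qed.

Section Fubini.
Variables (K : T1 -> T2 -> R) (a : T1 -> R) (b : T2 -> R).
Hypotheses (mK : measurable_fun setT (fun z => K z.1 z.2))
  (Ia : Int m1 a) (Ib : Int m2 b)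
  (Kab : forall x y, `|K x y| <= a x * b y).

Let IK : Int (m1 \x m2)%E (fun z => K z.1 z.2).
Proof. by apply: (Int_le mK (Int_tensor Ia Ib)) => -[x y]; exact: Kab. Qed.

(** The bound [Kab] holds everywhere, so every section is integrable and not just almost every one;
    the inner integrals are then finite everywhere and Fubini's theorem can be stated for real
    numbers. *)
Lemma tensor_Int1 x : Int m2 (K x).
Proof.
apply: (Int_le _ (IntZ (a x) Ib)) => //.
exact: (measurableT_comp mK (measurable_pair1 x)).
Qed.

Lemma tensor_Int2 y : Int m1 (K^~ y).
Proof.
apply: (Int_le _ (IntZ (b y) Ia)) => [|x]; last by rewrite mulrC.
exact: (measurableT_comp mK (measurable_pair2 y)).
Qed.

Let E1 x : ((\int[m2]_y K x y)%:E = \int[m2]_y (K x y)%:E)%E.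
Proof. by rewrite fineK//; apply: integrable_fin_num => //; exact: tensor_Int1. Qed.

Let E2 y : ((\int[m1]_x K x y)%:E = \int[m1]_x (K x y)%:E)%E.
Proof. by rewrite fineK//; apply: integrable_fin_num => //; exact: tensor_Int2. Qed.

Lemma tensor_Int12 : Int m1 (fun x => \int[m2]_y K x y).
Proof.
rewrite [X in _.-integrable _ X](_ : _ = fubini_F m2 (fun z => (K z.1 z.2)%:E)).
  exact: (integrable_fubini_F IK).
by apply/funext => x; exact: E1.
Qed.

Lemma Rfubini : \int[m1]_x (\int[m2]_y K x y) = \int[m2]_y (\int[m1]_x K x y).
Proof.
rewrite /Rintegral; congr fine.
under eq_integral do rewrite E1.
under [RHS]eq_integral do rewrite E2.
exact: (Fubini IK).
Qed.

End Fubini.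
End Tensor.

Lemma tensor_Int21 d1 d2 (T1 : measurableType d1) (T2 : measurableType d2)
    (R : realType) (m1 : {sigma_finite_measure set T1 -> \bar R})
    (m2 : {sigma_finite_measure set T2 -> \bar R})
    (K : T1 -> T2 -> R) (a : T1 -> R) (b : T2 -> R) :
  measurable_fun setT (fun z => K z.1 z.2) -> Int m1 a -> Int m2 b ->
  (forall x y, `|K x y| <= a x * b y) -> Int m2 (fun y => \int[m1]_x K x y).
Proof.
move=> mK Ia Ib Kab.
apply: (@tensor_Int12 _ _ _ _ _ m2 m1 (fun y x => K x y) b a) => //.
  exact: (measurableT_comp mK (measurable_fun_pair measurable_snd measurable_fst)).
by move=> y x; rewrite mulrC.
Qed.

(** * The weight 1 + |x|^2 *)

Section Weight.
Variable R : realType.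
Local Notation J := (@japanese2 R).
Implicit Types x y : R3 R.

Lemma dot_ge0 x : 0 <= dot x x.
Proof. by rewrite /dot -!expr2 !addr_ge0 ?sqr_ge0. Qed.

Lemma japanese2_ge1 x : 1 <= J x.
Proof. by rewrite lerDl dot_ge0. Qed.

Lemma japanese2_gt0 x : 0 < J x.
Proof. exact: lt_le_trans (japanese2_ge1 x). Qed.

Lemma japanese2_ge0 x : 0 <= J x.
Proof. exact/ltW/japanese2_gt0. Qed.

(* Peetre's inequality *)
Lemma japanese2D x y : J (x + y) <= 2 * J x * J y.
Proof.
rewrite /japanese2 /dot /=.
set a := x.1.1; set b := x.1.2; set c := x.2.
set p := y.1.1; set q := y.1.2; set r := y.2.
have H : 0 <= (a - p) ^+ 2 + (b - q) ^+ 2 + (c - r) ^+ 2.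
  by rewrite !addr_ge0 ?sqr_ge0.
have H2 : 0 <= (a ^+ 2 + b ^+ 2 + c ^+ 2) * (p ^+ 2 + q ^+ 2 + r ^+ 2).
  by rewrite mulr_ge0 // !addr_ge0 ?sqr_ge0.
nra.
Qed.

Lemma japanese20 : J 0 = 1.
Proof. by rewrite /japanese2 /dot/= !mulr0 !addr0. Qed.

Lemma japanese2V_bound_ge0 n (f : R3 R -> R) (C : R) :
  (forall x, `|f x| <= C * J x ^- n) -> 0 <= C.
Proof.
move=> /(_ 0); rewrite japanese20 expr1n invr1 mulr1; exact: le_trans.
Qed.

Lemma japanese2N x : J (- x) = J x.
Proof. by rewrite /japanese2 /dot /= !mulrNN. Qed.

(** Peetre's inequality for [y], written as the sum of [x + y] and [- x]. *)
Lemma japanese2VD n x y : J (x + y) ^- n <= 2 ^+ n * J x ^+ n * J y ^- n.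
Proof.
rewrite lter_pdivlMr ?exprn_gt0 ?japanese2_gt0// mulrC.
rewrite lter_pdivrMr ?exprn_gt0 ?japanese2_gt0// -!exprMn.
rewrite lerXn2r ?nnegrE ?mulr_ge0 ?japanese2_ge0//.
have -> : 2 * J x * J (x + y) = 2 * J (x + y) * J (- x).
  by rewrite japanese2N; ring.
by apply: le_trans (japanese2D _ _); rewrite addrAC subrr add0r.
Qed.

Lemma coord_le_japanese2 x :
  [/\ `|x.1.1| <= J x, `|x.1.2| <= J x & `|x.2| <= J x].
Proof.
rewrite /japanese2 /dot; set a := x.1.1; set b := x.1.2; set c := x.2.
have H (z : R) : `|z| <= 1 + z ^+ 2.
  by rewrite ler_norml; apply/andP; split; nra.
have := (sqr_ge0 a, sqr_ge0 b, sqr_ge0 c) => -[[/= Ha Hb] Hc].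
by split; apply: (le_trans (H _)); lra.
Qed.

Lemma continuous_coord11 : continuous (fun x : R3 R => x.1.1).
Proof. by move=> x; apply: continuous_comp; exact: cvg_fst. Qed.

Lemma continuous_coord12 : continuous (fun x : R3 R => x.1.2).
Proof.
by move=> x; apply: continuous_comp; [exact: cvg_fst|exact: cvg_snd].
Qed.

Lemma continuous_coord2 : continuous (fun x : R3 R => x.2).
Proof. by move=> x; exact: cvg_snd. Qed.

Lemma continuous_japanese2 : continuous J.
Proof.
move=> x; apply: cvgD; first exact: cvg_cst.
apply: cvgD; first apply: cvgD; apply: cvgM;
  solve [exact: continuous_coord11|exact: continuous_coord12
        |exact: continuous_coord2].
Qed.

Lemma continuous_japanese2X n : continuous (fun x => J x ^+ n).
Proof.
move=> x; apply: (@continuous_comp _ _ _ J (fun z => z ^+ n)).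
  exact: continuous_japanese2.
exact: exprn_continuous.
Qed.

Lemma continuous_japanese2V n : continuous (fun x => J x ^- n).
Proof.
move=> x; apply: cvgV; last exact: continuous_japanese2X.
by rewrite expf_neq0// gt_eqF// japanese2_gt0.
Qed.

Lemma measurable_japanese2 : measurable_fun [set: mR3 R] J.
Proof. by apply: measurable_fun_continuous3; exact: continuous_japanese2. Qed.

Lemma Int_oneDsqrV : Int (@lebesgue_measure R) (fun x : R => (oneDsqr x)^-1).
Proof.
apply/integrableP; split.
  apply/measurable_EFinP; apply: continuous_measurable_fun.
  exact: continuous_oneDsqrV.
under eq_integral do rewrite /= ger0_norm ?invr_ge0//.
rewrite ge0_symfun_integralT//.
- by rewrite -set_itvcy integral0y_oneDsqr -EFinM ltry.
- exact: continuous_oneDsqrV.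
- by move=> x /=; rewrite /oneDsqr sqrrN.
Qed.

(* The exponent 3 rather than 2, so that the weight is at most the product of
   the one-dimensional weights 1 / (1 + x_i^2). *)
Lemma Int_japanese2V3 : Int (leb3 R) (fun x => J x ^- 3).
Proof.
have I2 := Int_tensor Int_oneDsqrV Int_oneDsqrV.
have I3 : Int (leb3 R) (fun x =>
    (oneDsqr x.1.1)^-1 * (oneDsqr x.1.2)^-1 * (oneDsqr x.2)^-1).
  exact: (@Int_tensor _ _ _ _ _ (leb2 R) lebesgue_measure _ _ I2 Int_oneDsqrV).
apply: Int_le I3 _.
  exact: (measurable_fun_continuous3 (@continuous_japanese2V 3)).
move=> x; rewrite ger0_norm ?invr_ge0 ?exprn_ge0 ?japanese2_ge0//.
rewrite -!invfM lef_pV2 ?posrE ?exprn_gt0 ?japanese2_gt0//.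
have H (z : R) : z ^+ 2 <= dot x x -> oneDsqr z <= J x.
  by rewrite /oneDsqr lerD2l.
have := (sqr_ge0 x.1.1, sqr_ge0 x.1.2, sqr_ge0 x.2) => -[[/= Ha Hb] Hc].
have pos (z : R) : 0 <= oneDsqr z by rewrite (le_trans ler01)// oneDsqr_ge1.
rewrite exprSr expr2 !ler_pM ?mulr_ge0// H// /dot -!expr2; lra.
Qed.

End Weight.

(** * Smooth and Schwartz functions *)

Section Smooth.
Variable R : realType.
Implicit Types (f g : R3 R -> R) (x : R3 R).
Local Notation e_ i := (@Defs.basis R i).

(** Carries existence and value of the derivative together, so that the rules of calculus compose on
    explicit formulas. *)
Definition has_partial i f df := forall x, is_derive x (e_ i) f (df x).

Definition bounded_fun f := exists C : R, forall x, `|f x| <= C.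

Definition rapid_decay f :=
  forall N : nat, exists C : R, forall x, japanese2 x ^+ N * `|f x| <= C.

Definition bounded_smooth f :=
  smooth f /\ forall l, bounded_fun (iter_partial l f).

(** Turns a directional derivative into a derivative in one real variable, to which the
    one-dimensional chain rule applies. *)
Lemma is_derive_line x v f (df : R) :
  is_derive x v f df <-> is_derive (0 : R) 1 (fun t : R => f (t *: v + x)) df.
Proof.
have E : (fun h : R => h^-1 *: ((f \o shift x) (h *: v) - f x)) =
  (fun h : R => h^-1 *: (((fun t : R => f (t *: v + x)) \o shift 0) (h *: 1) -
     f (0 *: v + x))).
  by apply/funext => h /=; rewrite !scale0r !add0r addr0 scaler1.
split=> -[dx <-]; split; rewrite /derivable /derive; by [rewrite -E | rewrite E].
Qed.

Lemma has_partialE i f df : has_partial i f df -> partial i f = df.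
Proof. by move=> H; apply/funext => x; rewrite /partial (@derive_val _ _ _ _ _ _ _ (H x)). Qed.

Lemma has_partial_partial i f :
  (forall x, derivable f x (e_ i)) -> has_partial i f (partial i f).
Proof. by move=> H x; split. Qed.

Lemma smooth_partial i f : smooth f -> has_partial i f (partial i f).
Proof. by move=> /(_ [::])[_ H]; exact: has_partial_partial. Qed.

Lemma smooth_continuous f : smooth f -> continuous f.
Proof. by move=> /(_ [::])[]. Qed.

Lemma iter_partial_rcons l i f :
  iter_partial (rcons l i) f = iter_partial l (partial i f).
Proof. by rewrite /iter_partial foldr_rcons. Qed.

(* Smoothness is proved by coinduction: exhibit a class [K] of functions that is
   stable under partial derivatives. *)
Section Coinduction.
Variable K : set (R3 R -> R).
Hypothesis K_continuous : forall f, K f -> continuous f.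
Hypothesis K_partial : forall f i, K f -> exists2 df, K df & has_partial i f df.

Lemma iter_partial_class l f : K f -> K (iter_partial l f).
Proof.
move=> Kf; elim: l => // i l IH /=.
by have [df Kdf /has_partialE ->] := K_partial i IH.
Qed.

Lemma smooth_class f : K f -> smooth f.
Proof.
move=> Kf l; have Kl := iter_partial_class l Kf.
split; first exact: K_continuous.
by move=> i x; have [df _ /(_ x)[]] := K_partial i Kl.
Qed.

Lemma bounded_smooth_class f : (forall g, K g -> bounded_fun g) ->
  K f -> bounded_smooth f.
Proof.
move=> Kb Kf; split; first exact: smooth_class.
by move=> l; apply: Kb; exact: iter_partial_class.
Qed.

Lemma schwartz_class f : (forall g, K g -> rapid_decay g) -> K f -> schwartz f.
Proof.
move=> Kd Kf; split; first exact: smooth_class.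
by move=> l; apply: Kd; exact: iter_partial_class.
Qed.

End Coinduction.

Lemma schwartz_continuous f : schwartz f -> continuous f.
Proof. by move=> [/smooth_continuous]. Qed.

Lemma schwartz_decay f : schwartz f -> rapid_decay f.
Proof. by move=> [_ /(_ [::])]. Qed.

Lemma schwartz_has_partial i f : schwartz f -> has_partial i f (partial i f).
Proof. by move=> [+ _]; exact: smooth_partial. Qed.

Lemma smooth_partialS i f : smooth f -> smooth (partial i f).
Proof. by move=> sf l; rewrite -iter_partial_rcons. Qed.

Lemma schwartz_partial i f : schwartz f -> schwartz (partial i f).
Proof.
move=> [sf df]; split; first exact: smooth_partialS.
by move=> l; rewrite -iter_partial_rcons.
Qed.

Lemma bounded_smooth_partial i f : bounded_smooth f -> bounded_smooth (partial i f).
Proof.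
move=> [sf df]; split; first exact: smooth_partialS.
by move=> l; rewrite -iter_partial_rcons.
Qed.

Lemma bounded_smooth_bounded f : bounded_smooth f -> bounded_fun f.
Proof. by move=> [_ /(_ [::])]. Qed.

Lemma bounded_smooth_cst c : bounded_smooth (fun=> c).
Proof.
apply: (@bounded_smooth_class [set f | exists c, f = fun=> c]).
- by move=> _ [a ->]; exact: cst_continuous.
- move=> _ i [a ->]; exists (fun=> 0); first by exists 0.
  by move=> x; exact: is_derive_cst.
- by move=> _ [a ->]; exists `|a|.
- by exists c.
Qed.

Lemma has_partialD i f g df dg : has_partial i f df -> has_partial i g dg ->
  has_partial i (fun x => f x + g x) (fun x => df x + dg x).
Proof. by move=> Hf Hg x; have ? := Hf x; have ? := Hg x; exact: is_deriveD. Qed.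

Lemma has_partialM i f g df dg : has_partial i f df -> has_partial i g dg ->
  has_partial i (fun x => f x * g x) (fun x => f x * dg x + df x * g x).
Proof.
move=> Hf Hg x; have ? := Hf x; have ? := Hg x.
by apply: (is_derive_eq (is_deriveM _ _)); rewrite /= [df x * _]mulrC.
Qed.

Lemma rapid_decayD f g : rapid_decay f -> rapid_decay g ->
  rapid_decay (fun x => f x + g x).
Proof.
move=> Hf Hg N; have [A HA] := Hf N; have [B HB] := Hg N.
exists (A + B) => x; apply: le_trans (lerD (HA x) (HB x)).
by rewrite -mulrDr ler_wpM2l ?ler_normD// exprn_ge0// japanese2_ge0.
Qed.

Lemma rapid_decayM f g : bounded_fun f -> rapid_decay g ->
  rapid_decay (fun x => f x * g x).
Proof.
move=> [A HA] Hg N; have [B HB] := Hg N.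
exists (A * B) => x; rewrite normrM mulrCA ler_pM//.
by rewrite mulr_ge0// exprn_ge0// japanese2_ge0.
Qed.

(* The least additive class that contains the products and is closed under
   differentiation, by Leibniz' rule. *)
Inductive schwartz_span : (R3 R -> R) -> Prop :=
| schwartz_span_mul a f : bounded_smooth a -> schwartz f ->
    schwartz_span (fun x => a x * f x)
| schwartz_span_add f g : schwartz_span f -> schwartz_span g ->
    schwartz_span (fun x => f x + g x).

Lemma schwartz_spanP f : schwartz_span f -> schwartz f.
Proof.
apply: (@schwartz_class schwartz_span).
- move=> g; elim=> [a h [+ _] +|u v _ cu _ cv].
    move=> /smooth_continuous ca /schwartz_continuous ch x.
    by apply: cvgM; [exact: ca|exact: ch].
  by move=> x; apply: cvgD; [exact: cu|exact: cv].
- move=> g i; elim=> [a h sa sh|u v _ [du Ku hu] _ [dv Kv hv]].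
    exists (fun x => a x * partial i h x + partial i a x * h x).
      apply: schwartz_span_add; apply: schwartz_span_mul => //.
        exact: schwartz_partial.
      exact: bounded_smooth_partial.
    apply: has_partialM; last exact: schwartz_has_partial.
    by apply: smooth_partial; case: sa.
  exists (fun x => du x + dv x); first exact: schwartz_span_add.
  exact: has_partialD.
- move=> g; elim=> [a h sa sh|u v _ cu _ cv].
    apply: rapid_decayM; first exact: bounded_smooth_bounded.
    exact: schwartz_decay.
  exact: rapid_decayD.
Qed.

Lemma schwartzM a f : bounded_smooth a -> schwartz f ->
  schwartz (fun x => a x * f x).
Proof. by move=> sa sf; apply: schwartz_spanP; exact: schwartz_span_mul. Qed.

Lemma schwartzZ c f : schwartz f -> schwartz (fun x => c * f x).
Proof. exact/schwartzM/bounded_smooth_cst. Qed.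

Lemma schwartzD f g : schwartz f -> schwartz g -> schwartz (fun x => f x + g x).
Proof.
have E h : schwartz h -> schwartz_span h.
  move=> sh; have := schwartz_span_mul (bounded_smooth_cst 1) sh.
  by under eq_fun do rewrite mul1r.
by move=> /E sf /E sg; apply: schwartz_spanP; exact: schwartz_span_add.
Qed.

Lemma schwartzB f g : schwartz f -> schwartz g -> schwartz (fun x => f x - g x).
Proof.
move=> sf /(schwartzZ (-1)) sg; have := schwartzD sf sg.
by under eq_fun do rewrite mulN1r.
Qed.

Lemma has_partial_affine i f df (c : R) (a : R3 R) : has_partial i f df ->
  has_partial i (fun x => f (c *: x + a)) (fun x => c * df (c *: x + a)).
Proof.
move=> H x; apply/is_derive_line.
have /is_derive_line H1 := H (c *: x + a).
have E : (fun t : R => f (c *: (t *: e_ i + x) + a)) =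
  (fun t : R => f (t *: e_ i + (c *: x + a))) \o (fun t => c * t).
  by apply/funext => t /=; rewrite scalerDr scalerA addrA.
rewrite E mulrC; apply: is_derive1_comp; first by rewrite mulr0.
have ? : is_derive (0 : R) 1 (fun t : R => t) 1 by exact: is_derive_id.
by apply: (is_derive_eq (@is_deriveZ _ _ _ (fun t : R => t) c 0 1 1 _)); rewrite scaler1.
Qed.

Lemma schwartz_affine (c : R) (a : R3 R) f : c != 0 -> schwartz f ->
  schwartz (fun x => f (c *: x + a)).
Proof.
move=> c0 sf; apply: (@schwartz_class
  [set g | exists2 h, schwartz h & g = fun x => h (c *: x + a)]).
- move=> _ [h sh ->] x; apply: (@continuous_comp _ _ _ (fun x => c *: x + a) h).
    by apply: cvgD; [exact: scaler_continuous|exact: cvg_cst].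
  exact: schwartz_continuous.
- move=> _ i [h sh ->]; exists (fun x => c * partial i h (c *: x + a)).
    exists (fun x => c * partial i h x) => //.
    exact/schwartzZ/schwartz_partial.
  exact/has_partial_affine/schwartz_has_partial.
- move=> _ [h sh ->] N; have [C HC] := schwartz_decay sh N.
  have C0 : 0 <= C.
    by apply: le_trans (HC 0); rewrite mulr_ge0// exprn_ge0// japanese2_ge0.
  (* With [y = c *: x + a], Peetre's inequality is applied to [x = c^-1 *: y - c^-1 *: a]; the
     factor [1 + c ^- 2] bounds [japanese2 (c^-1 *: y)] by [japanese2 y]. *)
  pose B := 2 * (1 + c ^- 2) * japanese2 (- (c^-1 *: a)).
  have HB x : japanese2 x <= B * japanese2 (c *: x + a).
    set y := c *: x + a.
    have -> : x = c^-1 *: y + - (c^-1 *: a).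
      by rewrite scalerDr scalerA mulVf// scale1r addrK.
    apply: le_trans (japanese2D _ _) _.
    rewrite /B [leRHS]mulrAC ler_wpM2r ?japanese2_ge0// -[leRHS]mulrA ler_wpM2l//.
    rewrite /japanese2.
    have -> : dot (c^-1 *: y) (c^-1 *: y) = c ^- 2 * dot y y.
      by rewrite /dot/= /GRing.scale/=; field.
    have d0 := dot_ge0 y; have c20 : 0 <= c ^- 2 by rewrite invr_ge0 sqr_ge0.
    nra.
  have B0 : 0 <= B.
    by rewrite /B !mulr_ge0 ?japanese2_ge0// addr_ge0// invr_ge0 sqr_ge0.
  exists (B ^+ N * C) => x.
  apply: (@le_trans _ _ ((B * japanese2 (c *: x + a)) ^+ N * `|h (c *: x + a)|)).
    by rewrite ler_wpM2r// lerXn2r ?nnegrE ?(mulr_ge0 B0) ?japanese2_ge0//.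
  by rewrite exprMn -mulrA ler_wpM2l ?exprn_ge0.
- by exists f.
Qed.

(** Vanishing off the fixed set [S] passes to derivatives because the complement of [S] is open; a
    weighted derivative is then bounded as a continuous function on a compact set. *)
Lemma Cc_schwartz f : smooth_compact_support f -> schwartz f.
Proof.
move=> [sf cf]; set S := closure _ in cf.
apply: (@schwartz_class [set g | smooth g /\ forall x, ~ S x -> g x = 0]).
- by move=> g [/smooth_continuous].
- move=> g i [sg g0]; exists (partial i g); last exact: smooth_partial.
  split; first exact: smooth_partialS.
  move=> x nSx; rewrite /partial.
  have := @near_eq_derive _ _ _ g (cst 0) x (e_ i).
  rewrite derive_cst; apply.
  have oS : open (~` S) by apply: closed_openC; exact: closed_closure.
  by near do apply: g0; exact: open_nbhs_nbhs.
- move=> g [sg g0] N.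
  pose u x := japanese2 x ^+ N * `|g x|.
  have cu : continuous u.
    move=> x; apply: cvgM; first exact: continuous_japanese2X.
    by apply: (@cvg_norm _ _ _ _ _ g); exact: smooth_continuous.
  have /compact_bounded : compact (u @` S).
    by apply: continuous_compact => //; exact: continuous_subspaceT.
  move=> /pinfty_ex_gt0[C C0 HC]; exists C => x.
  have [Sx|nSx] := pselect (S x).
    by apply: le_trans (ler_norm _) _; apply: HC; exists x.
  by rewrite g0// normr0 mulr0 ltW.
- split => // x nSx; apply/eqP/negPn/negP => fx0.
  by apply: nSx; exact: subset_closure.
Unshelve. all: by end_near.
Qed.

Lemma schwartz_rescale f (eps : R) : 0 < eps -> schwartz f ->
  schwartz (rescale f eps).
Proof.
move=> e0 sf; have e1 : eps^-1 != 0 by rewrite invr_eq0 gt_eqF.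
have /(schwartzZ (eps ^- 3)) := schwartz_affine 0 e1 sf.
by under eq_fun do rewrite addr0.
Qed.

End Smooth.

(** * Integrals depending on a parameter *)

Lemma Rdominated_convergence d (T : measurableType d) (R : realType)
    (mu : {measure set T -> \bar R}) (f_ : nat -> T -> R) (f g : T -> R) :
  (forall n, measurable_fun setT (f_ n)) ->
  (forall x, f_ n x @[n --> \oo] --> f x) -> Int mu g ->
  (forall n x, `|f_ n x| <= g x) ->
  \int[mu]_x f_ n x @[n --> \oo] --> \int[mu]_x f x.
Proof.
move=> mf_ ff Ig fg.
have mf : measurable_fun setT f.
  by apply: (measurable_fun_cvg mf_) => x _; exact: ff.
have [] := @dominated_convergence _ _ _ mu setT measurableT
  (fun n y => (f_ n y)%:E) (fun y => (f y)%:E) (fun y => (g y)%:E).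
- by move=> n; exact/measurable_EFinP.
- exact/measurable_EFinP.
- by apply/aeW => y _; apply: cvg_EFin; [near=> n|exact: ff].
- exact: Ig.
- by apply/aeW => y n _ /=; rewrite lee_fin.
move=> If _; have -> : (\int[mu]_x (f x)%:E = (\int[mu]_x f x)%:E)%E.
  by rewrite fineK//; exact: integrable_fin_num.
exact: fine_cvg.
Unshelve. all: by end_near.
Qed.

Section ParametricIntegrals.
Variable R : realType.
Implicit Types (f df : R3 R -> R3 R -> R) (x : R3 R).
Local Notation e_ i := (@Defs.basis R i).
Local Notation J := (@japanese2 R).
Local Notation mu := (leb3 R).

(** Dominated convergence speaks of sequences; in a metric space these suffice for continuity,
    choosing a bad point in each ball of radius [n.+1%:R^-1]. *)
Lemma continuous_seq (F : R3 R -> R) x :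
  (forall u : nat -> R3 R, u n @[n --> \oo] --> x ->
    F (u n) @[n --> \oo] --> F x) -> {for x, continuous F}.
Proof.
move=> H; apply/cvgrPdist_lt => e e0; apply: contrapT => nH.
have /choice[u Hu] : forall n : nat, exists y : R3 R,
    ball x n.+1%:R^-1 y /\ ~ (`|F x - F y| < e).
  move=> n; apply: contrapT => /forallNP Hn; apply: nH.
  have n0 : 0 < n.+1%:R^-1 :> R by [].
  apply: filterS (nbhsx_ballx x _ n0) => y xy.
  by apply: contrapT => ?; exact: (Hn y).
have ux : u n @[n --> \oo] --> x.
  apply/cvg_ballP => d d0.
  near=> n; apply: le_ball (Hu n).1; apply/ltW.
  by near: n; exact: (near_infty_natSinv_lt (PosNum d0)).
have /cvgrPdist_lt/(_ e e0)[n _ Hn] := H u ux.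
by apply: (Hu n).2; apply: Hn => /=.
Unshelve. all: by end_near.
Qed.

(** The growth in [x] is what Peetre's inequality costs for a convolution kernel. The lemmas below
    use it through local boundedness: along a convergent sequence, or on a segment through [x]. *)
Definition dominated f := exists2 G : R3 R -> R, Int mu G &
  forall x y, `|f x y| <= J x ^+ 3 * G y.

Lemma dominated_Int f x : measurable_fun [set: mR3 R] (f x) -> dominated f ->
  Int mu (f x).
Proof.
by move=> mf [G IG fG]; apply: Int_le (IntZ _ IG) (fG x).
Qed.

Lemma integral_continuous f : (forall x, measurable_fun [set: mR3 R] (f x)) ->
  (forall y, continuous (f^~ y)) -> dominated f ->
  continuous (fun x => \int[mu]_y f x y).
Proof.
move=> mf cf df; have [G IG fG] := df.
move=> x; apply: continuous_seq => u ux.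
have [B HB] : exists B : R, forall n, J (u n) ^+ 3 <= B.
  have : cvgn (fun n => J (u n) ^+ 3).
    apply/cvg_ex; exists (J x ^+ 3).
    exact: (continuous_cvg _ (@continuous_japanese2X R 3 x) ux).
  move=> /cvg_seq_bounded/pinfty_ex_gt0[B B0 HB]; exists B => n.
  by apply: le_trans (ler_norm _) _; exact: HB.
have G0 y : 0 <= G y.
  have := fG 0 y; rewrite japanese20 expr1n mul1r.
  exact: le_trans.
apply: (@Rdominated_convergence _ _ _ mu (fun n => f (u n)) (f x)
  (fun y => B * G y)) => //.
- move=> y; have H0 := cf (y : R3 R) x.
  exact: (@continuous_cvg _ _ _ _ _ u (f^~ (y : R3 R)) x H0 ux).
- exact: IntZ.
- by move=> n y; rewrite (le_trans (fG _ _))// ler_wpM2r.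
Qed.

Lemma has_partial_along i (F dF : R3 R -> R) x (t : R) : has_partial i F dF ->
  is_derive t 1 (fun s : R => F (s *: e_ i + x)) (dF (t *: e_ i + x)).
Proof.
move=> HF.
have E : (fun s : R => F (s *: e_ i + x)) =
    (fun s : R => F (s *: e_ i + (t *: e_ i + x))) \o (fun s => s - t).
  by apply/funext => s /=; rewrite addrA -scalerDl subrK.
rewrite E -[dF _]mulr1; apply: is_derive1_comp.
  by rewrite subrr; apply/is_derive_line; exact: HF.
exact: is_derive_shift.
Qed.

Lemma integral_has_partial i f df :
  (forall x, measurable_fun [set: mR3 R] (f x)) ->
  (forall y, has_partial i (f^~ y) (df^~ y)) -> dominated f -> dominated df ->
  has_partial i (fun x => \int[mu]_y f x y) (fun x => \int[mu]_y df x y).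
Proof.
move=> mf pf Df [G IG dfG] x; apply/is_derive_line.
have G0 y : 0 <= G y.
  have := dfG 0 y; rewrite japanese20 expr1n mul1r.
  exact: le_trans.
pose g (t : R) (y : mR3 R) := f (t *: e_ i + x) y.
have dg (t : R) y : is_derive t 1 (fun s : R => g s y : R) (df (t *: e_ i + x) y).
  exact: (@has_partial_along _ (f^~ y) (df^~ y)).
have dgE t y : partial1of2 g t y = df (t *: e_ i + x) y.
  by rewrite partial1of2E; case: (dg t y).
have Je t : `]-1, 1[%classic t -> J (t *: e_ i) <= 2.
  rewrite /= in_itv/= => /andP[t1 t2]; rewrite /japanese2 /dot /=.
  have tt : t ^+ 2 <= 1 by nra.
  rewrite /GRing.scale/=; case: i {pf g dg dgE} => -[|[|[|//]]] ilt /=;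
  by rewrite ?mulr1 ?mulr0 ?addr0 ?add0r -expr2; lra.
have H : (fun h : R => h^-1 *: (\int[mu]_y g (h + 0) y - \int[mu]_y g 0 y)) @ 0^'
    --> \int[mu]_y partial1of2 g 0 y.
  (* The constant 4: by Peetre's inequality and [Je], [J (t *: e_ i + x) <= 2 * 2 * J x]. *)
  apply: (@cvg_differentiation_under_integral R _ _ mu g setT measurableT
    0 (-1) 1 _ _ _ (fun y => (4 * J x) ^+ 3 * G y)).
  - by rewrite /= in_itv/=; lra.
  - by move=> t _; exact: dominated_Int.
  - by move=> t y _ _; case: (dg t y).
  - by move=> y; rewrite mulr_ge0// exprn_ge0// mulr_ge0// japanese2_ge0.
  - exact: IntZ.
  - move=> t y It _; rewrite dgE (le_trans (dfG _ _))// ler_wpM2r//.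
    rewrite lerXn2r ?nnegrE ?mulr_ge0 ?japanese2_ge0//.
    apply: (le_trans (japanese2D _ _)); rewrite ler_wpM2r ?japanese2_ge0//.
    by have := Je t It; lra.
have E1 : \int[mu]_y partial1of2 g 0 y = \int[mu]_y df x y.
  by apply: eq_Rintegral => y _; rewrite dgE scale0r add0r.
rewrite {}E1 in H.
have E : (fun h : R => h^-1 *: (\int[mu]_y g (h + 0) y - \int[mu]_y g 0 y)) =
  (fun h : R => h^-1 *: (((fun t : R => \int[mu]_y f (t *: e_ i + x) y)
    \o shift 0) (h *: 1) - \int[mu]_y f (0 *: e_ i + x) y)).
  by apply/funext => h; rewrite /= /g scaler1.
rewrite E in H; split; last exact: cvg_lim H.
by apply/cvg_ex; eexists; exact: H.
Qed.

(* Translating the integrand does not change the integral, so the derivative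
   of the translated integral vanishes. *)
Lemma Rintegral_partial0 i (F dF : R3 R -> R) (C D : R) :
  continuous F -> has_partial i F dF ->
  (forall x, `|F x| <= C * J x ^- 3) -> (forall x, `|dF x| <= D * J x ^- 3) ->
  \int[mu]_x dF x = 0.
Proof.
move=> cF pF FC dFD.
have mF : measurable_fun [set: mR3 R] F by exact: measurable_fun_continuous3.
have IF : Int mu F by apply: Int_le mF (IntZ C (Int_japanese2V3 R)) FC.
have J0 x n : 0 <= J x ^+ n by rewrite exprn_ge0// japanese2_ge0.
have dom (H : R3 R -> R) (B : R) : (forall x, `|H x| <= B * J x ^- 3) ->
    dominated (fun x y => H (1 *: y + x)).
  move=> HB; exists (fun y => 2 ^+ 3 * B * J y ^- 3).
    exact: (IntZ _ (Int_japanese2V3 R)).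
  have B0 := japanese2V_bound_ge0 HB.
  move=> x y; rewrite scale1r (le_trans (HB _))//.
  rewrite addrC (le_trans (ler_wpM2l B0 (japanese2VD 3 x y)))//.
  by rewrite le_eqVlt; apply/orP; left; apply/eqP; field; rewrite gt_eqF// japanese2_gt0.
(* The translation carries the scalar 1 so that the affine change of variables applies to it as it
   stands. *)
have := @integral_has_partial i (fun x y => F (1 *: y + x))
   (fun x y => dF (1 *: y + x)).
move=> /(_ _ _ (dom _ _ FC) (dom _ _ dFD)) H.
have {}H : has_partial i (fun x => \int[mu]_y F (1 *: y + x))
   (fun x => \int[mu]_y dF (1 *: y + x)).
  apply: H => [x|y].
    exact: (measurableT_comp mF (measurable_fun_affine3 x (oner_neq0 _))).
  have := has_partial_affine 1 (1 *: y) pF.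
  have E (T : R3 R -> R) : (fun x => T (1 *: x + 1 *: y)) = (fun x => T (1 *: y + x)).
    by apply/funext => x; rewrite !scale1r addrC.
  rewrite E; under [X in has_partial _ _ X]eq_fun do rewrite mul1r.
  by rewrite E.
have := H 0; under eq_fun do
  rewrite Rintegral_affine3 ?oner_neq0// normr1 expr1n invr1 mul1r.
move=> H0.
have -> : \int[mu]_x dF x = \int[mu]_x dF (1 *: x + 0).
  by apply: eq_Rintegral => y _; rewrite addr0 scale1r.
by rewrite -(@derive_val _ _ _ _ _ _ _ H0) derive_cst.
Qed.

Lemma schwartz_japanese2V n (F : R3 R -> R) : schwartz F ->
  exists C : R, forall x, `|F x| <= C * J x ^- n.
Proof.
move=> /schwartz_decay/(_ n)[C HC]; exists C => x.
by rewrite ler_pdivlMr ?exprn_gt0 ?japanese2_gt0// mulrC.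
Qed.

Lemma schwartz_measurable (F : R3 R -> R) :
  schwartz F -> measurable_fun [set: mR3 R] F.
Proof. by move=> /schwartz_continuous cF; exact: measurable_fun_continuous3. Qed.

Lemma schwartz_Int (F : R3 R -> R) : schwartz F -> Int mu F.
Proof.
move=> sF; have [C HC] := schwartz_japanese2V 3 sF.
exact: Int_le (schwartz_measurable sF) (IntZ C (Int_japanese2V3 R)) HC.
Qed.

(* A convenient space that contains L^1 and L^2 and whose members are
   integrable against Schwartz functions. *)
Definition tempered (u : R3 R -> R) :=
  measurable_fun [set: mR3 R] u /\ Int mu (fun x => J x ^- 3 * u x).

Definition conv (F u : R3 R -> R) x := \int[mu]_y (F (x - y) * u y).

Lemma measurable_translate (F : R3 R -> R) x :
  measurable_fun [set: mR3 R] F -> measurable_fun [set: mR3 R] (fun y => F (x - y)).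
Proof.
move=> mF; have n1 : (-1 : R) != 0 by rewrite oppr_eq0 oner_eq0.
have := measurableT_comp mF (measurable_fun_affine3 x n1).
by rewrite /comp; under eq_fun do rewrite scaleN1r addrC.
Qed.

(** Peetre's inequality trades the decay of [F] at [x - y] for the factor [J x ^+ 3] and the weight
    [J y ^- 3] against which [u] is integrable. *)
Lemma conv_dominated (F u : R3 R -> R) : schwartz F -> tempered u ->
  dominated (fun x y => F (x - y) * u y).
Proof.
move=> sF [mu' Iu]; have [C HC] := schwartz_japanese2V 3 sF.
exists (fun y => 2 ^+ 3 * C * `|J y ^- 3 * u y|); first exact: IntZ (Int_norm Iu).
have C0 := japanese2V_bound_ge0 HC.
move=> x y; rewrite !normrM [`|J y ^- 3|]ger0_norm ?invr_ge0 ?exprn_ge0 ?japanese2_ge0//.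
rewrite !mulrA ler_wpM2r// (le_trans (HC _))//.
have := ler_wpM2l C0 (japanese2VD 3 x (- y)); rewrite japanese2N => /le_trans; apply.
rewrite le_eqVlt; apply/orP; left; apply/eqP; ring.
Qed.

Lemma conv_measurable (F u : R3 R -> R) x : measurable_fun [set: mR3 R] F ->
  tempered u -> measurable_fun [set: mR3 R] (fun y => F (x - y) * u y).
Proof.
by move=> mF [mu' _]; apply: measurable_funM => //; exact: measurable_translate.
Qed.

Lemma conv_Int (F u : R3 R -> R) x : schwartz F -> tempered u ->
  Int mu (fun y => F (x - y) * u y).
Proof.
move=> sF tu; apply: (@dominated_Int (fun x y => F (x - y) * u y)).
  by apply: conv_measurable => //; exact: schwartz_measurable.
exact: conv_dominated.
Qed.

Lemma conv_has_partial i (F u : R3 R -> R) : schwartz F -> tempered u ->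
  has_partial i (conv F u) (conv (partial i F) u).
Proof.
move=> sF tu; apply: integral_has_partial.
- by move=> x; apply: conv_measurable => //; exact: schwartz_measurable.
- move=> y.
  have := has_partialM (has_partial_affine 1 (- y) (schwartz_has_partial i sF))
    (fun x => is_derive_cst (u y) x (e_ i)).
  under eq_fun do rewrite scale1r.
  by under [X in has_partial _ _ X]eq_fun do rewrite mulr0 add0r mul1r scale1r.
- exact: conv_dominated.
- by apply: conv_dominated => //; exact: schwartz_partial.
Qed.

Lemma conv_continuous (F u : R3 R -> R) : schwartz F -> tempered u ->
  continuous (conv F u).
Proof.
move=> sF tu; apply: integral_continuous.
- by move=> x; apply: conv_measurable => //; exact: schwartz_measurable.
- move=> y x; apply: cvgM; last exact: cvg_cst.
  apply: (@continuous_comp _ _ _ (fun x => x - y) F).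
    by apply: cvgB; [exact: cvg_id|exact: cvg_cst].
  exact: schwartz_continuous.
- exact: conv_dominated.
Qed.

Lemma conv_smooth (F u : R3 R -> R) : schwartz F -> tempered u ->
  smooth (conv F u).
Proof.
move=> sF tu; apply: (@smooth_class _
  [set g | exists2 G, schwartz G & g = conv G u]).
- by move=> _ [G sG ->]; exact: conv_continuous.
- move=> _ i [G sG ->]; exists (conv (partial i G) u).
    by exists (partial i G) => //; exact: schwartz_partial.
  exact: conv_has_partial.
- by exists F.
Qed.

End ParametricIntegrals.

(** * Cosine transforms *)

Section CosineTransform.
Variable R : realType.
Implicit Types (h : R3 R -> R) (z xi : R3 R) (th : R).
Local Notation e_ i := (@Defs.basis R i).
Local Notation J := (@japanese2 R).
Local Notation mu := (leb3 R).

Definition coord i z : R := dot z (e_ i).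

(* The phase [th] lets one family of transforms be stable under
   differentiation: sine is a shifted cosine. *)
Definition cos_transform h th xi := \int[mu]_z (h z * cos (dot z xi + th)).

(** Stable under multiplication by a coordinate, hence a class whose transforms can be
    differentiated indefinitely. *)
Definition all_moments h :=
  measurable_fun [set: mR3 R] h /\ forall n, Int mu (fun z => J z ^+ n * h z).

Lemma all_moments_Int h : all_moments h -> Int mu h.
Proof. by move=> [_ /(_ 0%N)]; under eq_fun do rewrite expr0 mul1r. Qed.

Lemma schwartz_moments h : schwartz h -> all_moments h.
Proof.
move=> sh; have mh := schwartz_measurable sh; split=> // n.
have [C HC] := schwartz_japanese2V (n + 3) sh.
apply: (Int_le _ (IntZ C (Int_japanese2V3 R))) => [|z].
  apply: measurable_funM => //.
  by apply: measurable_fun_continuous3; exact: continuous_japanese2X.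
have Jz : 0 < J z ^+ n by rewrite exprn_gt0// japanese2_gt0.
rewrite normrM gtr0_norm// mulrC -ler_pdivlMr// -mulrA -invfM -exprD addnC.
exact: HC.
Qed.

Lemma dotC x y : dot x y = dot y x :> R.
Proof. by rewrite /dot; ring. Qed.

Lemma coord_le i z : `|coord i z| <= J z.
Proof.
have [H1 H2 H3] := coord_le_japanese2 z.
by case: i => -[|[|[|//]]] ilt; rewrite /coord /dot/= ?mulr1 ?mulr0 ?addr0 ?add0r.
Qed.

Lemma continuous_dotl xi : continuous (fun z => dot z xi).
Proof.
move=> x; apply: cvgD; first apply: cvgD; apply: cvgM; try exact: cvg_cst;
  solve [exact: continuous_coord11|exact: continuous_coord12
        |exact: continuous_coord2].
Qed.

Lemma all_moments_coord i h : all_moments h ->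
  all_moments (fun z => coord i z * h z).
Proof.
move=> [mh Ih]; split.
  apply: measurable_funM => //.
  by apply: measurable_fun_continuous3; exact: continuous_dotl.
move=> n; apply: (Int_le _ (Int_norm (Ih n.+1))) => [|z].
  apply: measurable_funM.
    by apply: measurable_fun_continuous3; exact: continuous_japanese2X.
  apply: measurable_funM => //.
  by apply: measurable_fun_continuous3; exact: continuous_dotl.
rewrite !normrM exprSr normrM -!mulrA ler_wpM2l// ler_wpM2r//.
by rewrite [leRHS]ger0_norm ?japanese2_ge0// coord_le.
Qed.

Lemma continuous_cos_dot xi th : continuous (fun z => cos (dot z xi + th)).
Proof.
move=> z; apply: (@continuous_comp _ _ _ (fun z => dot z xi + th) cos).
  by apply: cvgD; [exact: continuous_dotl|exact: cvg_cst].
exact: continuous_cos.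
Qed.

Lemma cos_transform_measurable h th xi : measurable_fun [set: mR3 R] h ->
  measurable_fun [set: mR3 R] (fun z => h z * cos (dot z xi + th)).
Proof.
move=> mh; apply: measurable_funM => //.
by apply: measurable_fun_continuous3; exact: continuous_cos_dot.
Qed.

Lemma cos_transform_dominated h th : all_moments h ->
  dominated (fun xi z => h z * cos (dot z xi + th)).
Proof.
move=> mh; exists (fun z => `|h z|); first exact/Int_norm/all_moments_Int.
move=> xi z; rewrite normrM mulrC ler_wpM2r// (le_trans (cos_max _))//.
by rewrite exprn_ege1// japanese2_ge1.
Qed.

Lemma is_derive_affine (a b t : R) :
  is_derive t 1 (fun s : R => a * s + b) a.
Proof.
have H := @is_deriveZ _ _ _ (fun t : R => t) a t 1 1 (is_derive_id t 1).
apply: (is_derive_eq (is_deriveD H (is_derive_cst b t 1))).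
by rewrite scaler1 addr0.
Qed.

Lemma cos_dot_has_partial i z th :
  has_partial i (fun xi => cos (dot z xi + th))
    (fun xi => coord i z * cos (dot z xi + (th + pi / 2))).
Proof.
move=> xi; apply/is_derive_line.
have E : (fun t : R => cos (dot z (t *: e_ i + xi) + th)) =
  cos \o (fun t => coord i z * t + (dot z xi + th)).
  apply/funext => t /=; congr cos; rewrite /coord /dot /= /GRing.scale /=; ring.
rewrite E mulrC addrA cosDpihalf.
apply: is_derive1_comp; last exact: is_derive_affine.
by apply: is_derive_eq; rewrite mulr0 add0r.
Qed.

Lemma cos_transform_has_partial i h th : all_moments h ->
  has_partial i (cos_transform h th)
    (cos_transform (fun z => coord i z * h z) (th + pi / 2)).
Proof.
move=> mh; apply: integral_has_partial.
- by move=> xi; apply: cos_transform_measurable; case: mh.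
- move=> z xi.
  have := @has_partialM _ i (fun=> h z) _ (fun=> 0) _
    (fun x => is_derive_cst (h z) x (e_ i)) (cos_dot_has_partial i z th) xi.
  by rewrite mul0r addr0 mulrA [coord i z * _]mulrC.
- exact: cos_transform_dominated.
- exact/cos_transform_dominated/all_moments_coord.
Qed.

Lemma cos_transform_continuous h th : all_moments h ->
  continuous (cos_transform h th).
Proof.
move=> mh; apply: integral_continuous.
- by move=> xi; apply: cos_transform_measurable; case: mh.
- move=> z xi; apply: cvgM; first exact: cvg_cst.
  by under eq_fun do rewrite dotC; rewrite dotC; exact: continuous_cos_dot.
- exact: cos_transform_dominated.
Qed.

Lemma cos_transform_Int h th xi : Int mu h ->
  Int mu (fun z => h z * cos (dot z xi + th)).
Proof.
move=> Ih; apply: (Int_le _ (Int_norm Ih)) => [|z].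
  by apply: cos_transform_measurable; exact: Int_measurable Ih.
by rewrite normrM ler_piMr// cos_max.
Qed.

Lemma cos_transform_le h th xi : Int mu h ->
  `|cos_transform h th xi| <= \int[mu]_z `|h z|.
Proof.
move=> Ih; have Ic := cos_transform_Int th xi Ih.
apply: le_trans (le_normr_Rintegral _ Ic) _ => //.
apply: le_Rintegral => //; [exact: Int_norm|exact: Int_norm|].
by move=> z _; rewrite normrM ler_piMr// cos_max.
Qed.

(** Each derivative brings down a coordinate and advances the phase by [pi / 2], so the transforms
    of functions with all moments form a class closed under differentiation; each is bounded by an
    L^1 norm. *)
Lemma cos_transform_bounded_smooth h th : all_moments h ->
  bounded_smooth (cos_transform h th).
Proof.
move=> mh; apply: (@bounded_smooth_class _
  [set g | exists u t, all_moments u /\ g = cos_transform u t]).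
- by move=> _ [u [t [mu' ->]]]; exact: cos_transform_continuous.
- move=> _ i [u [t [mu' ->]]].
  exists (cos_transform (fun z => coord i z * u z) (t + pi / 2)).
    by do 2 eexists; split; last reflexivity; exact: all_moments_coord.
  exact: cos_transform_has_partial.
- move=> _ [u [t [/all_moments_Int Iu ->]]].
  by exists (\int[mu]_z `|u z|) => xi; exact: cos_transform_le.
- by exists h, th.
Qed.

(* Integration by parts. *)
Lemma coord_cos_transform i h th xi : schwartz h ->
  coord i xi * cos_transform h th xi =
  - cos_transform (partial i h) (th - pi / 2) xi.
Proof.
move=> sh; have sp := schwartz_partial i sh.
(* The cosine is differentiated in [z], so [xi] and [z] exchange roles; the phase starts at
   [th - pi / 2] so that differentiation restores [th]. *)
have pF := has_partialM (schwartz_has_partial i sh) (fun z =>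
  (cos_dot_has_partial i xi (th - pi / 2)) z).
have [C HC] := schwartz_japanese2V 3 sh; have [D HD] := schwartz_japanese2V 3 sp.
rewrite subrK in pF.
have Z : \int[mu]_z (h z * (coord i xi * cos (dot xi z + th)) +
    partial i h z * cos (dot xi z + (th - pi / 2))) = 0.
  apply: (Rintegral_partial0 (C := C) (D := `|coord i xi| * C + D) _ pF).
  - move=> z; apply: cvgM; first exact: schwartz_continuous.
    by under eq_fun do rewrite dotC; rewrite dotC; exact: continuous_cos_dot.
  - by move=> z; rewrite normrM (le_trans _ (HC z))// ler_piMr// cos_max.
  - move=> z; rewrite (le_trans (ler_normD _ _))// [leRHS]mulrDl lerD//.
      rewrite !normrM mulrCA -mulrA ler_wpM2l// (le_trans _ (HC z))//.
      by rewrite ler_piMr// cos_max.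
    by rewrite normrM (le_trans _ (HD z))// ler_piMr// cos_max.
have E1 z : h z * (coord i xi * cos (dot xi z + th)) =
    coord i xi * (h z * cos (dot z xi + th)) by rewrite dotC mulrCA.
have E2 z : partial i h z * cos (dot xi z + (th - pi / 2)) =
    partial i h z * cos (dot z xi + (th - pi / 2)) by rewrite dotC.
have I1 := cos_transform_Int th xi (schwartz_Int sh).
have I2 := cos_transform_Int (th - pi / 2) xi (schwartz_Int sp).
move: Z; under eq_Rintegral do rewrite E1 E2.
rewrite RintegralD//; last exact: IntZ.
by rewrite RintegralZl// => /eqP; rewrite addr_eq0 => /eqP.
Qed.

Lemma dot_coord xi : dot xi xi = \sum_(i < 3) coord i xi ^+ 2.
Proof.
rewrite !big_ord_recl big_ord0 /coord /dot /=; ring.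
Qed.

(** Two integrations by parts in each direction: [J xi] is the symbol of the identity minus the
    Laplacian, and the minus sign sits in the phase shift by [- pi]. *)
Lemma japanese2_cos_transform h th xi : schwartz h ->
  J xi * cos_transform h th xi = cos_transform h th xi +
    \sum_(i < 3) cos_transform (partial i (partial i h)) (th - pi / 2 - pi / 2) xi.
Proof.
move=> sh; rewrite /japanese2 mulrDl mul1r dot_coord mulr_suml; congr (_ + _).
apply: eq_bigr => i _; rewrite expr2 -mulrA coord_cos_transform// mulrN.
by rewrite coord_cos_transform ?opprK//; exact: schwartz_partial.
Qed.

(** Each power of [J] costs two derivatives of [h] and a shift of the phase, so the induction on the
    power runs over all [h] and [th]. *)
Lemma cos_transform_decay h th : schwartz h -> rapid_decay (cos_transform h th).
Proof.
move=> + n; elim: n h th => [|n IH] h th sh.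
  exists (\int[mu]_z `|h z|) => xi; rewrite expr0 mul1r.
  exact/cos_transform_le/schwartz_Int.
have [C0 H0] := IH h th sh.
have /choice[C HC] : forall i : 'I_3, exists C, forall xi, J xi ^+ n *
    `|cos_transform (partial i (partial i h)) (th - pi / 2 - pi / 2) xi| <= C.
  by move=> i; apply: IH; do 2 apply: schwartz_partial.
exists (C0 + \sum_(i < 3) C i) => xi.
rewrite exprSr -mulrA -[J xi in X in _ * X]ger0_norm ?japanese2_ge0//.
rewrite -normrM japanese2_cos_transform//.
rewrite (le_trans (ler_wpM2l _ (ler_normD _ _))) ?exprn_ge0 ?japanese2_ge0//.
rewrite mulrDr lerD//.
rewrite (le_trans (ler_wpM2l _ (ler_norm_sum _ _ _))) ?exprn_ge0 ?japanese2_ge0//.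
by rewrite mulr_sumr ler_sum.
Qed.

End CosineTransform.

(** * Duality of convolution and averaging *)

Section ConvolutionTheorem.
Variable R : realType.
Implicit Types (M a G u : R3 R -> R) (x y z xi : R3 R) (th : R).
Local Notation J := (@japanese2 R).
Local Notation mu := (leb3 R).

Lemma measurable_add3 : measurable_fun [set: mR3 R * mR3 R]
  (fun p : mR3 R * mR3 R => ((p.1 : R3 R) + (p.2 : R3 R)) : mR3 R).
Proof.
have m1 (f : mR3 R -> R) : measurable_fun setT f ->
    measurable_fun setT (fun p : mR3 R * mR3 R => f p.1 + f p.2).
  move=> mf; apply: measurable_funD; first exact: measurableT_comp mf measurable_fst.
  exact: measurableT_comp mf measurable_snd.
apply: measurable_fun_pair; first apply: measurable_fun_pair.
- exact: (m1 (fun x => x.1.1) (measurableT_comp measurable_fst measurable_fst)).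
- exact: (m1 (fun x => x.1.2) (measurableT_comp measurable_snd measurable_fst)).
- exact: (m1 (fun x => x.2) measurable_snd).
Qed.

Lemma measurable_sub3 : measurable_fun [set: mR3 R * mR3 R]
  (fun p : mR3 R * mR3 R => ((p.2 : R3 R) - (p.1 : R3 R)) : mR3 R).
Proof.
have n1 : (-1 : R) != 0 by rewrite oppr_eq0 oner_eq0.
have mN := measurable_fun_affine3 0 n1.
have := measurableT_comp measurable_add3
  (measurable_fun_pair measurable_snd (measurableT_comp mN measurable_fst)).
by rewrite /comp /=; under eq_fun do rewrite scaleN1r addr0.
Qed.

(* The adjoint of [conv M], by [average_dual]. *)
Definition average M G x := \int[mu]_z (M z * G (x + z)).

Section Duality.
Variables (M u G : R3 R -> R) (D : R).
Hypotheses (sM : schwartz M) (tu : tempered u)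
  (mG : measurable_fun [set: mR3 R] G) (GD : forall y, `|G y| <= D * J y ^- 6).

Let K x y := u x * (M (y - x) * G y).

Let mK : measurable_fun setT (fun p : mR3 R * mR3 R => K p.1 p.2).
Proof.
apply: measurable_funM; first exact: measurableT_comp tu.1 measurable_fst.
apply: measurable_funM; last exact: measurableT_comp mG measurable_snd.
exact: measurableT_comp (schwartz_measurable sM) measurable_sub3.
Qed.

(** Moving the decay of [M] from [y - x] to [x] costs [J y ^+ 3]; of the [J y ^- 6] supplied by
    [GD], the integrable [J y ^- 3] remains. *)
Let KE : exists B : R, forall x y,
  `|K x y| <= `|J x ^- 3 * u x| * (B * J y ^- 3).
Proof.
have [C HC] := schwartz_japanese2V 3 sM.
have C0 := japanese2V_bound_ge0 HC.
exists (2 ^+ 3 * C * D) => x y.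
have J0 z n : 0 < J z ^+ n by rewrite exprn_gt0// japanese2_gt0.
have MC : `|M (y - x)| <= C * (2 ^+ 3 * J y ^+ 3 * J x ^- 3).
  apply: le_trans (HC _) _; rewrite ler_wpM2l//.
  by have := japanese2VD 3 y (- x); rewrite japanese2N.
rewrite /K !normrM [`|J x ^- 3|]gtr0_norm ?invr_gt0//.
apply: (@le_trans _ _ (`|u x| *
    (C * (2 ^+ 3 * J y ^+ 3 * J x ^- 3) * (D * J y ^- 6)))).
  by rewrite ler_wpM2l// ler_pM.
rewrite le_eqVlt; apply/orP; left; apply/eqP; field.
by rewrite !gt_eqF ?japanese2_gt0.
Qed.

Let IB B : Int mu (fun y => B * J y ^- 3).
Proof. exact: (IntZ B (Int_japanese2V3 R)). Qed.

Let inner1 x : \int[mu]_y K x y = u x * average M G x.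
Proof.
have [B HB] := KE; have Ix := tensor_Int1 mK (IB B) HB x.
pose f y := M (y - x) * G y.
have If : Int mu f.
  (* Exponent 0: with [x] fixed, boundedness of [M] is enough, since [G] alone is integrable. *)
  have [C HC] := schwartz_japanese2V 0 sM.
  have JV0 z n : 0 <= J z ^- n by rewrite invr_ge0 exprn_ge0// japanese2_ge0.
  have mM : measurable_fun [set: mR3 R] (fun y => M (y - x)).
    have := measurableT_comp (schwartz_measurable sM)
      (measurable_fun_affine3 (- x) (oner_neq0 R)).
    by rewrite /comp; under eq_fun do rewrite scale1r.
  apply: (Int_le _ (IB (C * D))) => [|y]; first exact: measurable_funM.
  have C0 := le_trans (normr_ge0 _) (HC 0).
  rewrite invr1 mulr1 in C0.
  have D0 := japanese2V_bound_ge0 GD.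
  rewrite normrM -mulrA ler_pM//; first by have := HC (y - x); rewrite invr1 mulr1.
  rewrite (le_trans (GD y))// ler_wpM2l// lef_pV2 ?posrE ?exprn_gt0 ?japanese2_gt0//.
  by rewrite ler_weXn2l// japanese2_ge1.
rewrite RintegralZl//; congr (_ * _).
have := Rintegral_affine3 x (oner_neq0 R) If.
rewrite normr1 expr1n invr1 mul1r => <-.
apply: eq_Rintegral => z _; rewrite /f scale1r.
by rewrite addrK addrC.
Qed.

Let inner2 y : \int[mu]_x K x y = conv M u y * G y.
Proof.
have [B HB] := KE; have Iy := tensor_Int2 mK (Int_norm tu.2) HB y.
rewrite /conv -RintegralZr//; last exact: conv_Int.
by apply: eq_Rintegral => x _; rewrite /K; ring.
Qed.

Lemma Int_average : Int mu (fun x => u x * average M G x).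
Proof.
have [B HB] := KE.
by have := tensor_Int12 mK (Int_norm tu.2) (IB B) HB; under eq_fun do rewrite inner1.
Qed.

Lemma Int_conv : Int mu (fun y => conv M u y * G y).
Proof.
have [B HB] := KE.
by have := tensor_Int21 mK (Int_norm tu.2) (IB B) HB; under eq_fun do rewrite inner2.
Qed.

Lemma average_dual :
  \int[mu]_x (u x * average M G x) = \int[mu]_y (conv M u y * G y).
Proof.
have [B HB] := KE.
under eq_Rintegral do rewrite -inner1.
under [RHS]eq_Rintegral do rewrite -inner2.
exact: (Rfubini mK (Int_norm tu.2) (IB B) HB).
Qed.

End Duality.

Lemma measurable_dot : measurable_fun [set: mR3 R * mR3 R]
  (fun p : mR3 R * mR3 R => dot (p.1 : R3 R) (p.2 : R3 R)).
Proof.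
have m1 (f : mR3 R -> R) : measurable_fun setT f ->
    measurable_fun setT (fun p : mR3 R * mR3 R => f p.1 * f p.2).
  move=> mf; apply: measurable_funM; first exact: measurableT_comp mf measurable_fst.
  exact: measurableT_comp mf measurable_snd.
apply: measurable_funD; first apply: measurable_funD.
- exact: (m1 (fun x => x.1.1) (measurableT_comp measurable_fst measurable_fst)).
- exact: (m1 (fun x => x.1.2) (measurableT_comp measurable_snd measurable_fst)).
- exact: (m1 (fun x => x.2) measurable_snd).
Qed.

Section AverageTransform.
Variables (M a : R3 R -> R) (th : R) (x : R3 R).
Hypotheses (sM : schwartz M) (sa : schwartz a).

Let K z xi := M z * (a xi * cos (dot xi (x + z) + th)).

Let mK : measurable_fun setT (fun p : mR3 R * mR3 R => K p.1 p.2).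
Proof.
apply: measurable_funM.
  exact: measurableT_comp (schwartz_measurable sM) measurable_fst.
apply: measurable_funM.
  exact: measurableT_comp (schwartz_measurable sa) measurable_snd.
apply: (@measurableT_comp _ _ _ _ _ _ (@cos R)).
  by apply: continuous_measurable_fun; exact: continuous_cos.
apply: measurable_funD => //.
have mx : measurable_fun [set: mR3 R] (fun z : mR3 R => (x + (z : R3 R)) : mR3 R).
  have := measurable_fun_affine3 x (oner_neq0 R).
  by under eq_fun do rewrite scale1r addrC.
exact: (measurableT_comp measurable_dot
  (measurable_fun_pair measurable_snd (measurableT_comp mx measurable_fst))).
Qed.

Let KE z xi : `|K z xi| <= `|M z| * `|a xi|.
Proof. by rewrite !normrM mulrA ler_piMr// cos_max. Qed.

Let IM := schwartz_Int sM.
Let Ia := schwartz_Int sa.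

(** The addition formula for the cosine, with both sines written as cosines shifted by
    [- pi / 2]. *)
Let inner2 xi : \int[mu]_z K z xi =
  cos_transform M 0 xi * a xi * cos (dot xi x + th) -
  cos_transform M (- (pi / 2)) xi * a xi * cos (dot xi x + (th - pi / 2)).
Proof.
have I1 := cos_transform_Int 0 xi IM.
have I2 := cos_transform_Int (- (pi / 2)) xi IM.
rewrite -2!mulrA -RintegralZr// -RintegralZr// -RintegralB//; last 2 first.
- by have := IntZ (a xi * cos (dot xi x + th)) I1; under eq_fun do rewrite mulrC.
- by have := IntZ (a xi * cos (dot xi x + (th - pi / 2))) I2; under eq_fun do rewrite mulrC.
apply: eq_Rintegral => z _; rewrite /K.
have -> : dot xi (x + z) + th = (dot xi x + th) + dot z xi.
  by rewrite /dot /=; ring.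
by rewrite addr0 [dot xi x + (th - _)]addrA !cosBpihalf cosD; ring.
Qed.

(** Fubini exchanges the average with the transform. This is the real form of the identity that the
    average of a transform is the transform of a product with Mhat; the two terms come from the
    complex product. *)
Lemma average_cos_transform : average M (cos_transform a th) x =
  cos_transform (fun xi => cos_transform M 0 xi * a xi) th x -
  cos_transform (fun xi => cos_transform M (- (pi / 2)) xi * a xi) (th - pi / 2) x.
Proof.
have bs t := schwartz_Int (schwartzM (cos_transform_bounded_smooth t (schwartz_moments sM)) sa).
rewrite /cos_transform -RintegralB//; last 2 first.
- exact: (cos_transform_Int _ _ (bs _)).
- exact: (cos_transform_Int _ _ (bs _)).
under [RHS]eq_Rintegral do rewrite -inner2.
rewrite -(Rfubini mK (Int_norm IM) (Int_norm Ia) KE).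
apply: eq_Rintegral => z _; rewrite RintegralZl//.
exact: cos_transform_Int.
Qed.

End AverageTransform.

Lemma cos_transformD h1 h2 th xi : Int mu h1 -> Int mu h2 ->
  cos_transform (fun z => h1 z + h2 z) th xi =
  cos_transform h1 th xi + cos_transform h2 th xi.
Proof.
move=> I1 I2; rewrite /cos_transform -RintegralD//; last 2 first.
- exact: cos_transform_Int.
- exact: cos_transform_Int.
by apply: eq_Rintegral => z _; rewrite mulrDl.
Qed.

Lemma cos_transformB h1 h2 th xi : Int mu h1 -> Int mu h2 ->
  cos_transform (fun z => h1 z - h2 z) th xi =
  cos_transform h1 th xi - cos_transform h2 th xi.
Proof.
move=> I1 I2; rewrite /cos_transform -RintegralB//; last 2 first.
- exact: cos_transform_Int.
- exact: cos_transform_Int.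
by apply: eq_Rintegral => z _; rewrite mulrBl.
Qed.

Lemma cos_transform_pi h th xi : Int mu h ->
  cos_transform h (th - pi / 2 - pi / 2) xi = - cos_transform h th xi.
Proof.
move=> Ih; rewrite /cos_transform -RintegralN; last exact: cos_transform_Int.
apply: eq_Rintegral => z _.
by rewrite addrA cosBpihalf addrA sinBpihalf mulrN.
Qed.

End ConvolutionTheorem.

(** * Fourier transform of a convolution *)

Section SquareIntegrable.
Context d (T : measurableType d) (R : realType).
Variable mu : {measure set T -> \bar R}.
Implicit Types f g : T -> R.

Lemma Lnorm2E f :
  ('N[mu]_2%:E[EFin \o f] = (\int[mu]_x (f x ^+ 2)%:E) `^ 2^-1)%E.
Proof.
rewrite unlock; congr (_ `^ _)%E; apply: eq_integral => x _ /=.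
by rewrite powR_mulrn// real_normK// num_real.
Qed.

Lemma Lfun2P f : f \in Lfun mu 2%:E <->
  measurable_fun setT f /\ Int mu (fun x => f x ^+ 2).
Proof.
split=> [f2|[mf /integrableP[_ If]]].
  split; last exact: Lfun2_integrable_sqr.
  by move: f2; rewrite inE => /andP[/[!inE]].
rewrite inE; apply/andP; split; rewrite inE//=.
rewrite /finite_norm Lnorm2E; apply: poweR_lty.
apply: le_lt_trans If; rewrite le_eqVlt; apply/orP; left; apply/eqP.
by apply: eq_integral => x _ /=; rewrite ger0_norm// sqr_ge0.
Qed.

Lemma Lfun2D f g : f \in Lfun mu 2%:E -> g \in Lfun mu 2%:E ->
  (fun x => f x + g x) \in Lfun mu 2%:E.
Proof.
move=> /Lfun2P[mf If] /Lfun2P[mg Ig]; apply/Lfun2P.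
have mfg : measurable_fun setT (fun x => f x + g x) by exact: measurable_funD.
split=> //; apply: (Int_le _ (IntZ 2 (IntD If Ig))) => [|x].
  exact: measurable_funX.
rewrite ger0_norm ?sqr_ge0//; have := sqr_ge0 (f x - g x); nra.
Qed.

Lemma Lfun2_bounded f g (C : R) : measurable_fun setT f ->
  (forall x, `|f x| <= C) -> g \in Lfun mu 2%:E ->
  (fun x => f x * g x) \in Lfun mu 2%:E.
Proof.
move=> mf fC /Lfun2P[mg Ig]; apply/Lfun2P; split; first exact: measurable_funM.
apply: (Int_le _ (IntZ (C ^+ 2) Ig)) => [|x].
  by apply: measurable_funX; exact: measurable_funM.
rewrite normrX normrM exprMn -[g x ^+ 2]real_normK ?num_real//.
rewrite ler_wpM2r ?sqr_ge0// lerXn2r ?nnegrE//.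
exact: le_trans (normr_ge0 _) (fC x).
Qed.

Lemma Lfun2M_Int f g : f \in Lfun mu 2%:E -> g \in Lfun mu 2%:E ->
  Int mu (fun x => f x * g x).
Proof. by move=> Hf Hg; have /Lfun1_integrable := Lfun2_mul_Lfun1 Hf Hg. Qed.

End SquareIntegrable.

Section ComplexFourier.
Variable R : realType.
Implicit Types (M : R3 R -> R) (f g phi psi : R3 R -> R[i]) (x y z xi : R3 R).
Local Notation J := (@japanese2 R).
Local Notation mu := (leb3 R).
(** [ct] and [st] are the cosine and the sine transform, a phase of [- pi / 2] turning cosine into
    sine. *)
Local Notation ct h := (cos_transform h 0).
Local Notation st h := (cos_transform h (- (pi / 2))).
Local Notation c := ((2 * pi) `^ (- (3 / 2)) : R).

Lemma japanese2V_Lfun2 (f : R3 R -> R) C : measurable_fun [set: mR3 R] f ->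
  (forall x, `|f x| <= C * J x ^- 3) -> f \in Lfun mu 2%:E.
Proof.
move=> mf HC; apply/Lfun2P; split=> //.
apply: (Int_le _ (IntZ (C ^+ 2) (Int_japanese2V3 R))) => [|x].
  exact: measurable_funX.
rewrite normrX (le_trans (lerXn2r 2 _ _ (HC x))) ?nnegrE//.
  exact: le_trans (normr_ge0 _) (HC x).
rewrite exprMn ler_wpM2l ?sqr_ge0// expr2 ler_piMr//.
  by rewrite invr_ge0 exprn_ge0// japanese2_ge0.
by rewrite invf_le1 ?exprn_ege1// ?exprn_gt0// ?japanese2_gt0// japanese2_ge1.
Qed.

Lemma schwartz_Lfun2 M : schwartz M -> M \in Lfun mu 2%:E.
Proof.
move=> sM; have [C HC] := schwartz_japanese2V 3 sM.
exact: japanese2V_Lfun2 (schwartz_measurable sM) HC.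
Qed.

(** For [0 <= a <= 1] and [0 <= v] one has [a * v <= a + v ^+ 2]: compare [v] with 1. *)
Lemma Lfun2_tempered (u : R3 R -> R) : u \in Lfun mu 2%:E -> tempered u.
Proof.
move=> /Lfun2P[mu' Iu]; split=> //.
apply: (Int_le _ (IntD (Int_japanese2V3 R) Iu)) => [|x].
  apply: measurable_funM => //.
  by apply: measurable_fun_continuous3; exact: continuous_japanese2V.
set a := J x ^- 3.
have a0 : 0 <= a by rewrite invr_ge0 exprn_ge0// japanese2_ge0.
have a1 : a <= 1.
  by rewrite invf_le1 ?exprn_ege1// ?exprn_gt0// ?japanese2_gt0// japanese2_ge1.
rewrite normrM ger0_norm// -[u x ^+ 2]real_normK ?num_real//.
have := normr_ge0 (u x); set v := `|u x| => v0.
nra.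
Qed.

Lemma ReM (a b : R[i]) : complex.Re (a * b) =
  complex.Re a * complex.Re b - complex.Im a * complex.Im b.
Proof. by case: a b => [a1 a2] [b1 b2]. Qed.

Lemma ImM (a b : R[i]) : complex.Im (a * b) =
  complex.Re a * complex.Im b + complex.Im a * complex.Re b.
Proof. by case: a b => [a1 a2] [b1 b2]. Qed.

Lemma complex_eq (a b : R[i]) : complex.Re a = complex.Re b ->
  complex.Im a = complex.Im b -> a = b.
Proof. by case: a b => [a1 a2] [b1 b2] /= -> ->. Qed.

Lemma fourier_integralE psi xi : cschwartz psi ->
  let a := reF psi in let b := imF psi in
  fourier_integral psi xi =
    ((c * (ct a xi + st b xi)) +i* (c * (ct b xi - st a xi)))%C.
Proof.
move=> [sa sb] a b.
have [Ia Ib] := (schwartz_Int sa, schwartz_Int sb).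
have E : cintegral (fun x => expi (- dot x xi) * psi x) =
    ((ct a xi + st b xi) +i* (ct b xi - st a xi))%C.
  congr (_ +i* _)%C; rewrite /cos_transform.
  - rewrite -RintegralD//; [|exact: cos_transform_Int|exact: cos_transform_Int].
    apply: eq_Rintegral => x _.
    by rewrite /reF ReM /expi /= cosN sinN cosBpihalf addr0 /a /b /reF /imF; ring.
  - rewrite -RintegralB//; [|exact: cos_transform_Int|exact: cos_transform_Int].
    apply: eq_Rintegral => x _.
    by rewrite /imF ImM /expi /= cosN sinN cosBpihalf addr0 /a /b /reF /imF; ring.
rewrite /fourier_integral E.
by apply: complex_eq; rewrite ?ReM ?ImM /= mul0r ?subr0 ?addr0.
Qed.

(** [mollify m eps] is convertible to [cconv (rescale m eps)]; a general kernel keeps the scale out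
    of the convolution theorem. *)
Definition cconv M phi x := cintegral (fun y => (M (x - y))%:C%C * phi y).

Lemma cconvE M phi :
  cconv M phi = fun x => (conv M (reF phi) x +i* conv M (imF phi) x)%C.
Proof.
apply/funext => x; congr (_ +i* _)%C; apply: eq_Rintegral => y _.
  by rewrite /reF ReM /= mul0r subr0.
by rewrite /imF ImM /= mul0r addr0.
Qed.

(* The integral of M(z) e^(- i z . xi). *)
Definition multiplier M xi : R[i] := (ct M xi +i* - st M xi)%C.

Lemma multiplier_cschwartz M psi : schwartz M -> cschwartz psi ->
  cschwartz (fun xi => multiplier M xi * psi xi).
Proof.
move=> sM [sa sb].
have bs t := cos_transform_bounded_smooth t (schwartz_moments sM).
split.
  have := schwartzD (schwartzM (bs 0) sa) (schwartzM (bs (- (pi / 2))) sb).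
  congr schwartz; apply/funext => x.
  by rewrite /reF ReM /= mulNr opprK.
have := schwartzB (schwartzM (bs 0) sb) (schwartzM (bs (- (pi / 2))) sa).
by congr schwartz; apply/funext => x; rewrite /imF ImM /= mulNr.
Qed.

Lemma multiplier_cL2 M g : schwartz M -> cL2 g ->
  cL2 (fun xi => multiplier M xi * g xi).
Proof.
move=> sM [ga gb].
have IM := schwartz_Int sM.
have mc t : measurable_fun [set: mR3 R] (cos_transform M t).
  apply: measurable_fun_continuous3.
  exact: cos_transform_continuous (schwartz_moments sM).
have bd t xi := cos_transform_le t xi IM.
have mcN t : measurable_fun [set: mR3 R] (fun xi => - cos_transform M t xi).
  exact: measurable_funN.
have bdN t xi : `|- cos_transform M t xi| <= \int[mu]_z `|M z|.
  by rewrite normrN.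
split.
  rewrite (_ : reF _ = fun x => ct M x * reF g x + st M x * imF g x); last first.
    by apply/funext => x; rewrite /reF ReM /= mulNr opprK.
  by apply: Lfun2D; [exact: Lfun2_bounded (mc _) (bd _) ga
                    |exact: Lfun2_bounded (mc _) (bd _) gb].
rewrite (_ : imF _ = fun x => ct M x * imF g x + (- st M x) * reF g x); last first.
  by apply/funext => x; rewrite /imF ImM.
by apply: Lfun2D; [exact: Lfun2_bounded (mc _) (bd _) gb
                  |exact: Lfun2_bounded (mcN _) (bdN _) ga].
Qed.

Section FourierConvolution.
Variables (M : R3 R -> R) (psi : R3 R -> R[i]).
Hypotheses (sM : schwartz M) (spsi : cschwartz psi).
Let a := reF psi.
Let b := imF psi.
(** [P] and [Q] are the real and imaginary parts of [fourier_integral psi], by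
    [fourier_integralE]. *)
Let P xi := c * (ct a xi + st b xi).
Let Q xi := c * (ct b xi - st a xi).

Let cos_transform_japanese2V h th : schwartz h ->
  exists C : R, forall y, `|cos_transform h th y| <= C * J y ^- 6.
Proof.
move=> sh; have [C HC] := cos_transform_decay th sh 6; exists C => y.
by rewrite ler_pdivlMr ?exprn_gt0 ?japanese2_gt0// mulrC.
Qed.

Let combination_japanese2V (k : R) h1 h2 th1 th2 (s : R) : schwartz h1 -> schwartz h2 ->
  exists C : R, forall y, `|k * (cos_transform h1 th1 y + s * cos_transform h2 th2 y)| <=
    C * J y ^- 6.
Proof.
move=> s1 s2; have [A HA] := cos_transform_japanese2V th1 s1.
have [B HB] := cos_transform_japanese2V th2 s2.
exists (`|k| * (A + `|s| * B)) => y; rewrite normrM -mulrA ler_wpM2l//.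
rewrite (le_trans (ler_normD _ _))// mulrDl lerD// normrM -mulrA ler_wpM2l//.
Qed.

Let cos_transform_meas h th : schwartz h ->
  measurable_fun [set: mR3 R] (cos_transform h th).
Proof.
move=> sh; apply: measurable_fun_continuous3.
exact: cos_transform_continuous (schwartz_moments sh).
Qed.

Let sa : schwartz a := spsi.1.
Let sb : schwartz b := spsi.2.

Let mP : measurable_fun [set: mR3 R] P.
Proof.
by apply: measurable_funM => //; apply: measurable_funD; exact: cos_transform_meas.
Qed.

Let mQ : measurable_fun [set: mR3 R] Q.
Proof.
by apply: measurable_funM => //; apply: measurable_funB; exact: cos_transform_meas.
Qed.

Let PD : exists C : R, forall y, `|P y| <= C * J y ^- 6.
Proof.
have [C HC] := combination_japanese2V c 0 (- (pi / 2)) 1 sa sb.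
by exists C => y; rewrite (le_trans _ (HC y))// mul1r.
Qed.

Let QD : exists C : R, forall y, `|Q y| <= C * J y ^- 6.
Proof.
have [C HC] := combination_japanese2V c 0 (- (pi / 2)) (-1) sb sa.
by exists C => y; rewrite (le_trans _ (HC y))// mulN1r.
Qed.

Let Mt (t : R) h (sh : schwartz h) x :
  Int mu (fun z => M z * cos_transform h t (x + z)).
Proof.
have [Ch _] := cos_transform_bounded_smooth t (schwartz_moments sh).
have Ih := schwartz_Int sh.
apply: (Int_le _ (IntZ (\int[mu]_z `|h z|) (Int_norm (schwartz_Int sM)))) => [|z].
  apply: measurable_funM; first exact: schwartz_measurable.
  have := measurableT_comp (cos_transform_meas t sh)
    (measurable_fun_affine3 x (oner_neq0 R)).
  by rewrite /comp; under eq_fun do rewrite scale1r addrC.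
by rewrite normrM mulrC ler_wpM2r// cos_transform_le.
Qed.

Lemma fourier_multiplier x :
  fourier_integral (fun xi => multiplier M xi * psi xi) x =
  (average M P x +i* average M Q x)%C.
Proof.
rewrite fourier_integralE; last exact: multiplier_cschwartz.
have Im t h (sh : schwartz h) : Int mu (fun xi => cos_transform M t xi * h xi).
  exact: (schwartz_Int (schwartzM (cos_transform_bounded_smooth t (schwartz_moments sM)) sh)).
have reE : reF (fun xi => multiplier M xi * psi xi) =
    fun xi => ct M xi * a xi + st M xi * b xi.
  by apply/funext => xi; rewrite /reF ReM /= mulNr opprK.
have imE : imF (fun xi => multiplier M xi * psi xi) =
    fun xi => ct M xi * b xi - st M xi * a xi.
  by apply/funext => xi; rewrite /imF ImM /= mulNr.
have avP : average M P x = c * (average M (ct a) x + average M (st b) x).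
  rewrite /average -RintegralD//; [|exact: Mt|exact: Mt].
  rewrite -RintegralZl//; last by apply: IntD; exact: Mt.
  by apply: eq_Rintegral => z _; rewrite /P; ring.
have avQ : average M Q x = c * (average M (ct b) x - average M (st a) x).
  rewrite /average -RintegralB//; [|exact: Mt|exact: Mt].
  rewrite -RintegralZl//; last by apply: IntB; exact: Mt.
  by apply: eq_Rintegral => z _; rewrite /Q; ring.
(* Shifting the sine transform by another quarter period gives minus the cosine transform. *)
have pi2 h : Int mu h -> cos_transform h (- (pi / 2) - pi / 2) x = - ct h x.
  by move=> /cos_transform_pi <-; rewrite sub0r.
rewrite reE imE !cos_transformB; try exact: Im.
rewrite !cos_transformD; try exact: Im.
rewrite avP avQ !average_cos_transform// !sub0r !pi2; try exact: Im.
by congr (_ +i* _)%C; ring.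
Qed.

(** Read off from the decay of [P] and [Q]; it makes the pairings in [is_fourierB] integrable, so
    that they can be split. *)
Lemma fourier_integral_cL2 : cL2 (fourier_integral psi).
Proof.
have J36 D y : 0 <= D -> D * J y ^- 6 <= D * J y ^- 3.
  move=> D0; rewrite ler_wpM2l// lef_pV2 ?posrE ?exprn_gt0 ?japanese2_gt0//.
  by rewrite ler_weXn2l// japanese2_ge1.
have [C HC] := PD; have [D HD] := QD; split.
  rewrite (_ : reF _ = P); last first.
    by apply/funext => x; rewrite /reF fourier_integralE.
  apply: (japanese2V_Lfun2 (C := C) mP) => y.
  by rewrite (le_trans (HC y))// J36// (japanese2V_bound_ge0 HC).
rewrite (_ : imF _ = Q); last first.
  by apply/funext => x; rewrite /imF fourier_integralE.
apply: (japanese2V_Lfun2 (C := D) mQ) => y.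
by rewrite (le_trans (HD y))// J36// (japanese2V_bound_ge0 HD).
Qed.

Lemma Int_conv_fourier u : tempered u ->
  [/\ Int mu (fun x => conv M u x * P x), Int mu (fun x => conv M u x * Q x),
    Int mu (fun x => u x * average M P x) & Int mu (fun x => u x * average M Q x)].
Proof.
move=> tu; have [C HC] := PD; have [D HD] := QD; split.
- exact: Int_conv HC.
- exact: Int_conv HD.
- exact: Int_average HC.
- exact: Int_average HD.
Qed.

Lemma cconv_dual phi : tempered (reF phi) -> tempered (imF phi) ->
  cintegral (fun x => phi x * fourier_integral (fun xi => multiplier M xi * psi xi) x) =
  cintegral (fun x => cconv M phi x * fourier_integral psi x).
Proof.
move=> tp tq.
have [C HC] := PD; have [D HD] := QD.
have [IpP IpQ JpP JpQ] := Int_conv_fourier tp.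
have [IqP IqQ JqP JqQ] := Int_conv_fourier tq.
under eq_fun do rewrite fourier_multiplier.
under [in RHS]eq_fun do rewrite cconvE fourier_integralE//.
congr (_ +i* _)%C.
- transitivity (\int[mu]_x (reF phi x * average M P x - imF phi x * average M Q x)).
    by apply: eq_Rintegral => x _; rewrite /reF ReM.
  rewrite RintegralB// (average_dual sM tp mP HC) (average_dual sM tq mQ HD).
  by rewrite -RintegralB.
- transitivity (\int[mu]_x (reF phi x * average M Q x + imF phi x * average M P x)).
    by apply: eq_Rintegral => x _; rewrite /imF ImM.
  rewrite RintegralD// (average_dual sM tp mQ HD) (average_dual sM tq mP HC).
  by rewrite -RintegralD.
Qed.

End FourierConvolution.

(** The multiplier moves onto the test function, which stays Schwartz, and [cconv_dual] hands it
    back to [phi] as a convolution. *)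
Lemma is_fourier_cconv M phi g : schwartz M ->
  tempered (reF phi) -> tempered (imF phi) -> is_fourier phi g ->
  is_fourier (cconv M phi) (fun xi => multiplier M xi * g xi).
Proof.
move=> sM tp tq [g2 Hg]; split; first exact: multiplier_cL2.
move=> psi spsi; rewrite -cconv_dual// -Hg; last exact: multiplier_cschwartz.
by congr cintegral; apply/funext => xi; rewrite mulrAC mulrC.
Qed.
End ComplexFourier.

(** * Uniqueness of the Fourier transform *)

Section Orthants.
Variable R : realType.
Local Notation mu := (leb3 R).

(** Open orthants form a generating family closed under intersection, and their indicators are
    limits of products of continuous functions of one coordinate. *)
Definition orthant (a : R3 R) : set (mR3 R) :=
  [set x : mR3 R | [/\ a.1.1 < x.1.1, a.1.2 < x.1.2 & a.2 < x.2]].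

Definition orthants : set (set (mR3 R)) := range orthant.

Lemma orthants_setI : setI_closed orthants.
Proof.
move=> _ _ [a _ <-] [b _ <-].
exists (Num.max a.1.1 b.1.1, Num.max a.1.2 b.1.2, Num.max a.2 b.2) => //.
apply/seteqP; split => x /=.
  by move=> [] /=; rewrite !gt_max => /andP[? ?] /andP[? ?] /andP[? ?].
by move=> [[] + + + []] /=; rewrite /orthant /= !gt_max => -> -> -> -> -> ->.
Qed.

Lemma measurable_orthants : @measurable _ (mR3 R) = <<s orthants >>.
Proof.
apply/seteqP; split; last first.
  apply: smallest_sub; first exact: sigma_algebra_measurable.
  move=> _ [a _ <-].
  rewrite (_ : orthant a = `]a.1.1, +oo[ `*` `]a.1.2, +oo[ `*` `]a.2, +oo[); last first.
    apply/seteqP; split => x /=; rewrite !in_itv/= !andbT.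
      by move=> [].
    by move=> [[]].
  by apply: measurableX => //; apply: measurableX.
pose T := g_sigma_algebraType orthants.
(* A half-space in one coordinate is the countable union of the orthants whose two other thresholds
   go to minus infinity. *)
have coordm (f : R3 R -> R) (F : R -> nat -> R3 R) :
    (forall a, [set x : R3 R | a < f x] = \bigcup_n orthant (F a n)) ->
    measurable_fun [set: T] (f : T -> mR R).
  move=> HF; apply: (measurability _ (RGenOInfty.measurableE R)).
  move=> _ [_ [a ->] <-]; rewrite setTI.
  rewrite (_ : _ @^-1` _ = \bigcup_n orthant (F a n)).
    apply: bigcupT_measurable => n.
    by apply: sub_sigma_algebra; exists (F a n).
  rewrite -HF; apply/seteqP; split => x /=; rewrite in_itv/= andbT//.
have lt (t : R) : exists N : nat, forall n, (N <= n)%N -> - n%:R < t.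
  exists (Num.truncn `|t|).+1 => n Nn; rewrite ltrNl.
  apply: (@le_lt_trans _ _ `|t|); first by rewrite -normrN ler_norm.
  rewrite (lt_le_trans (truncnS_gt _))// ler_nat//.
have mid : measurable_fun [set: T] (fun x : T => (x : mR3 R)).
  apply/measurable_fun_pairP; split; first apply/measurable_fun_pairP; first split.
  - apply: (coordm (fun x => x.1.1) (fun a n => (a, - n%:R, - n%:R))) => a.
    apply/seteqP; split => [x /= ax|x [n _ []]//].
    have [N1 H1] := lt x.1.2; have [N2 H2] := lt x.2.
    exists (maxn N1 N2) => //; split => //=; [apply: H1|apply: H2].
      exact: leq_maxl.
    exact: leq_maxr.
  - apply: (coordm (fun x => x.1.2) (fun a n => (- n%:R, a, - n%:R))) => a.
    apply/seteqP; split => [x /= ax|x [n _ []]//].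
    have [N1 H1] := lt x.1.1; have [N2 H2] := lt x.2.
    exists (maxn N1 N2) => //; split => //=; [apply: H1|apply: H2].
      exact: leq_maxl.
    exact: leq_maxr.
  - apply: (coordm (fun x => x.2) (fun a n => (- n%:R, - n%:R, a))) => a.
    apply/seteqP; split => [x /= ax|x [n _ []]//].
    have [N1 H1] := lt x.1.1; have [N2 H2] := lt x.1.2.
    exists (maxn N1 N2) => //; split => //=; [apply: H1|apply: H2].
      exact: leq_maxl.
    exact: leq_maxr.
move=> A mA; have := mid measurableT A mA; rewrite setTI; exact.
Qed.

Lemma measurable_orthant a : measurable (orthant a).
Proof. by rewrite measurable_orthants; apply: sub_sigma_algebra; exists a. Qed.

Section ZeroIntegrals.
Variable p : R3 R -> R.
Hypothesis Ip : Int mu p.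

(** Dynkin's theorem: the sets over which [p] integrates to 0 are closed under countable disjoint
    unions and, since the total integral is 0, under complements. *)
Lemma ae0_orthants : \int[mu]_x p x = 0 ->
  (forall a, \int[mu]_(x in orthant a) p x = 0) ->
  {ae mu, forall x, p x = 0}.
Proof.
move=> pT pG.
have IpA A : measurable A -> mu.-integrable A (EFin \o p).
  by move=> mA; apply: integrableS Ip.
have fE A : measurable A -> \int[mu]_(x in A) p x = 0 ->
    (\int[mu]_(x in A) (p x)%:E = 0)%E.
  by move=> mA H; rewrite -[LHS]fineK ?[fine _]H//; apply: integrable_fin_num (IpA _ mA).
have H A : measurable A -> (\int[mu]_(x in A) (p x)%:E = 0)%E.
  move=> mA; apply: (@dynkin_induction _ _ orthants
    (fun A => (\int[mu]_(x in A) (p x)%:E = 0)%E)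
    measurable_orthants orthants_setI) => //.
  - exact: fE.
  - by move=> _ [a _ <-]; apply: fE => //; exact: measurable_orthant.
  - move=> S mS S0; have mSC := measurableC mS.
    apply: fE => //.
    have := @Rintegral_setU _ _ _ mu S (~` S) p mS mSC.
    rewrite setUv pT => /(_ Ip); rewrite /Rintegral S0/= add0r => <- //.
    by apply/disj_setPS; rewrite setICr.
  - move=> F mF tF F0; rewrite integral_bigcup//.
      by rewrite eseries0// => n _ _; exact: F0.
    by apply: IpA; exact: bigcupT_measurable.
  - by rewrite -measurable_orthants.
have := @integral_ae_eq _ _ _ mu setT measurableT (cst 0%E) (EFin \o p) Ip.
move=> /(_ (measurable_cst _)) H0.
have {H0} : ae_eq mu setT (EFin \o p) (cst 0%E).
  by apply: H0 => E _ mE; rewrite H// integral0.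
by apply: filterS => x /(_ I)/= [].
Qed.

(* Converges pointwise to the indicator function of the positive reals. *)
Definition ramp (n : nat) (t : R) : R := 1 - (1 + (t + `|t|)) ^- n.

Let ramp_base t : 1 <= 1 + (t + `|t|) :> R.
Proof. by have := ler_norm (- t); rewrite normrN; lra. Qed.

Lemma ramp_ge0_le1 n t : 0 <= ramp n t <= 1.
Proof.
have b1 := ramp_base t; have b0 := lt_le_trans ltr01 b1.
rewrite /ramp subr_ge0 lerBlDr lerDl invr_ge0.
by rewrite invf_le1 ?exprn_gt0// exprn_ege1// exprn_ge0 ?ltW.
Qed.

Lemma continuous_ramp n : continuous (ramp n).
Proof.
move=> t; apply: cvgB; first exact: cvg_cst.
have b0 := lt_le_trans ltr01 (ramp_base t).
apply: cvgV; first by rewrite expf_neq0// gt_eqF.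
apply: (@continuous_comp _ _ _ (fun t : R => 1 + (t + `|t|)) (fun z => z ^+ n)).
  apply: cvgD; first exact: cvg_cst.
  by apply: cvgD; [exact: cvg_id|exact: norm_continuous].
exact: exprn_continuous.
Qed.

Lemma cvg_ramp t : ramp n t @[n --> \oo] --> ((0 < t)%R%:R : R).
Proof.
have [t0|t0] := ltP 0 t; last first.
  rewrite /ramp ler0_norm//; under eq_fun do rewrite subrr addr0 expr1n invr1 subrr.
  exact: cvg_cst.
rewrite -[1%:R]subr0; apply: cvgB; first exact: cvg_cst.
under eq_fun do rewrite -exprVn; apply: cvg_expr.
have b0 := lt_le_trans ltr01 (ramp_base t).
rewrite ger0_norm ?invr_ge0 ?ltW// invf_lt1//.
by rewrite ltrDl ger0_norm ?ltW// addr_gt0.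
Qed.

(** Products of three ramps are continuous, bounded by 1, and converge pointwise to the indicator of
    an orthant; dominated convergence with bound [|p|] passes to the limit. *)
Lemma ae0_continuous : (forall u : R3 R -> R, continuous u ->
    (forall x, `|u x| <= 1) -> \int[mu]_x (p x * u x) = 0) ->
  {ae mu, forall x, p x = 0}.
Proof.
move=> H; apply: ae0_orthants.
  have := H (fun=> 1) (@cst_continuous _ _ _) _.
  by under eq_Rintegral do rewrite mulr1; apply => x; rewrite normr1.
move=> a.
pose u n x := ramp n (x.1.1 - a.1.1) * ramp n (x.1.2 - a.1.2) * ramp n (x.2 - a.2).
have cu n : continuous (u n).
  move=> x; by apply: cvgM; first apply: cvgM;
    [apply: (@continuous_comp _ _ _ (fun x : R3 R => x.1.1 - a.1.1) (ramp n))
    |apply: (@continuous_comp _ _ _ (fun x : R3 R => x.1.2 - a.1.2) (ramp n))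
    |apply: (@continuous_comp _ _ _ (fun x : R3 R => x.2 - a.2) (ramp n))];
    try exact: continuous_ramp; apply: cvgB; try exact: cvg_cst;
    [exact: continuous_coord11|exact: continuous_coord12|exact: continuous_coord2].
have u1 n x : `|u n x| <= 1.
  have := (ramp_ge0_le1 n (x.1.1 - a.1.1), ramp_ge0_le1 n (x.1.2 - a.1.2),
    ramp_ge0_le1 n (x.2 - a.2)) => -[[/andP[r0 r1] /andP[s0 s1]] /andP[t0 t1]].
  by rewrite ger0_norm ?mulr_ge0// mulr_ile1 ?mulr_ge0// mulr_ile1.
have cv x : u n x @[n --> \oo] --> ((x \in orthant a)%:R : R).
  have -> : (x \in orthant a)%:R = (0 < x.1.1 - a.1.1)%R%:R *
      (0 < x.1.2 - a.1.2)%R%:R * (0 < x.2 - a.2)%R%:R :> R.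
    rewrite !subr_gt0 -!natrM !mulnb; congr (nat_of_bool _)%:R.
    by apply/idP/idP => [/set_mem[-> -> ->]//|/andP[/andP[? ?] ?]]; apply/mem_set.
  by apply: cvgM; first apply: cvgM; exact: cvg_ramp.
have := @Rdominated_convergence _ _ _ mu (fun n x => p x * u n x)
  (fun x => p x * (x \in orthant a)%:R) (fun x => `|p x|).
move=> /(_ _ _ (Int_norm Ip) _) C.
have {C} : \int[mu]_x (p x * u n x) @[n --> \oo] -->
    \int[mu]_x (p x * (x \in orthant a)%:R).
  apply: C => [n|x|n x].
  - apply: measurable_funM; first exact: Int_measurable Ip.
    exact: measurable_fun_continuous3.
  - by apply: cvgM; [exact: cvg_cst|exact: cv].
  - by rewrite normrM ler_piMr.
under eq_fun do rewrite H//.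
move=> /(cvg_unique (@Rhausdorff R) (cvg_cst 0)) E.
rewrite Rintegral_mkcond [RHS]E; apply: eq_Rintegral => x _.
by rewrite patchE; case: ifPn; rewrite ?mulr1 ?mulr0.
Qed.

End ZeroIntegrals.
End Orthants.

Section Uniqueness.
Variable R : realType.
Variable m : R3 R -> R.
Hypotheses (sm : schwartz m) (m1 : \int[leb3 R]_x m x = 1).
Local Notation mu := (leb3 R).
Local Notation J := (@japanese2 R).

(** The substitution [z = eps *: w] moves the scale into the argument of [v]. Constant [v] gives the
    mass of the rescaled kernel, and a cosine gives its transform. *)
Lemma average_rescale (eps : R) (v : R3 R -> R) x : 0 < eps ->
  Int mu (fun w => m w * v (x + eps *: w)) ->
  average (rescale m eps) v x = \int[mu]_w (m w * v (x + eps *: w)).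
Proof.
move=> e0 If; have e1 : eps^-1 != 0 by rewrite invr_eq0 gt_eqF.
have If' := integrable_affine3 0 e1 If.
have := Rintegral_affine3 0 e1 If.
rewrite gtr0_norm ?invr_gt0// => E.
apply: (mulfI (_ : eps ^+ 3 != 0)); first by rewrite expf_neq0// gt_eqF.
rewrite -[eps ^+ 3 in RHS]invrK -exprVn -{}E.
rewrite /average -RintegralZl//; last first.
  have := IntZ (eps ^- 3) If'; congr (_.-integrable _ _); apply/funext => z /=.
  rewrite /rescale mulrA; congr (_ * _ * _)%:E; rewrite ?addr0// scalerA.
  by rewrite mulfV ?gt_eqF// scale1r.
apply: eq_Rintegral => z _; rewrite /rescale addr0 scalerA mulfV ?gt_eqF// scale1r.
by rewrite !mulrA mulfV ?mul1r// expf_neq0// gt_eqF.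
Qed.

Section TestSchwartz.
Variable h : R3 R -> R.
Hypotheses (th : tempered h)
  (h0 : forall F, schwartz F -> \int[mu]_x (h x * F x) = 0).

(* The function y |-> M (x - y) is itself a Schwartz function. *)
Lemma conv_eq0 M x : schwartz M -> conv M h x = 0.
Proof.
move=> sM; have n1 : (-1 : R) != 0 by rewrite oppr_eq0 oner_eq0.
rewrite -(h0 (schwartz_affine x n1 sM)); apply: eq_Rintegral => y _.
by rewrite mulrC scaleN1r addrC.
Qed.

Section TestContinuous.
Variable v : R3 R -> R.
Hypotheses (cv : continuous v) (vJ : forall x, `|v x| <= J x ^- 6).

Let mv : measurable_fun [set: mR3 R] v.
Proof. exact: measurable_fun_continuous3. Qed.

Let vJ1 x : `|v x| <= 1 * J x ^- 6. Proof. by rewrite mul1r. Qed.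

Let vJ3 x : `|v x| <= J x ^- 3.
Proof.
rewrite (le_trans (vJ x))// lef_pV2 ?posrE ?exprn_gt0 ?japanese2_gt0//.
by rewrite ler_weXn2l// japanese2_ge1.
Qed.

Let v1 x : `|v x| <= 1.
Proof.
rewrite (le_trans (vJ x))// invf_le1 ?exprn_gt0 ?japanese2_gt0//.
by rewrite exprn_ege1// japanese2_ge1.
Qed.

Let eps (n : nat) : R := n.+1%:R^-1.

Let eps_gt0 n : 0 < eps n. Proof. by rewrite invr_gt0. Qed.

Let mint n (x : R3 R) : measurable_fun [set: mR3 R] (fun w => m w * v (x + eps n *: w)).
Proof.
apply: measurable_funM; first exact: schwartz_measurable.
have := measurableT_comp mv (measurable_fun_affine3 x (lt0r_neq0 (eps_gt0 n))).
by rewrite /comp; under eq_fun do rewrite addrC.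
Qed.

Let Iint n (x : R3 R) : Int mu (fun w => m w * v (x + eps n *: w)).
Proof.
apply: (Int_le (mint n x) (Int_norm (schwartz_Int sm))) => w.
by rewrite normrM ler_piMr.
Qed.

Let cvg_average (x : R3 R) :
  average (rescale m (eps n)) v x @[n --> \oo] --> v x.
Proof.
under eq_fun do rewrite average_rescale//.
have -> : v x = \int[mu]_w (m w * v x).
  by rewrite RintegralZr ?m1 ?mul1r//; exact: schwartz_Int.
apply: (@Rdominated_convergence _ _ _ mu (fun n w => m w * v (x + eps n *: w))
  _ (fun w => `|m w|)) => //.
- move=> w; apply: cvgM; first exact: cvg_cst.
  have E : (x + eps n *: (w : R3 R)) @[n --> \oo] --> (x : R3 R).
    rewrite -[X in _ --> X]addr0; apply: cvgD; first exact: cvg_cst.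
    rewrite -(scale0r (w : R3 R)); apply: cvgZr_tmp.
    exact: cvg_harmonic.
  have H := @continuous_cvg _ _ _ _ _ _ v x (@cv x) E.
  exact: H.
- exact/Int_norm/schwartz_Int.
- by move=> n w; rewrite normrM ler_piMr.
Qed.

(** As [eps n <= 1], Peetre's inequality bounds [v (x + eps n *: w)] by
    [2 ^+ 3 * J w ^+ 3 * J x ^- 3]; [C] is the resulting moment of [m], uniform in [n]. *)
Let C := \int[mu]_w `|2 ^+ 3 * (J w ^+ 3 * m w)|.

Let ICw : Int mu (fun w => 2 ^+ 3 * (J w ^+ 3 * m w)).
Proof. by apply: IntZ; exact: (schwartz_moments sm).2. Qed.

Let average_le n (x : R3 R) : `|average (rescale m (eps n)) v x| <= C * J x ^- 3.
Proof.
rewrite average_rescale// (le_trans (le_normr_Rintegral _ (Iint n x)))//.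
rewrite /C -RintegralZr//; last exact: Int_norm ICw.
apply: le_Rintegral => //; first exact: Int_norm (Iint n x).
  by have := IntZ (J x ^- 3) (Int_norm ICw); under eq_fun do rewrite mulrC.
move=> w _; rewrite mulrA [X in _ <= X / _]normrM [X in X * `|m w| / _]ger0_norm; last first.
  by rewrite mulr_ge0 ?exprn_ge0 ?japanese2_ge0.
rewrite normrM mulrC [leRHS]mulrAC ler_wpM2r//.
rewrite (le_trans (vJ3 _))// addrC (le_trans (japanese2VD 3 _ _))//.
rewrite ler_wpM2r ?invr_ge0 ?exprn_ge0 ?japanese2_ge0//.
rewrite ler_wpM2l ?exprn_ge0// lerXn2r ?nnegrE ?japanese2_ge0//.
rewrite /japanese2 lerD2l.
have -> : dot (eps n *: (w : R3 R)) (eps n *: (w : R3 R)) = eps n ^+ 2 * dot w w.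
  by rewrite /dot/= /GRing.scale/=; ring.
rewrite ler_piMl ?dot_ge0// exprn_ile1//; first exact: ltW.
by rewrite invf_le1 ?ler1n.
Qed.

Lemma Rintegral_continuous_eq0 : \int[mu]_x (h x * v x) = 0.
Proof.
have sr n := schwartz_rescale (eps_gt0 n) sm.
have : \int[mu]_x (h x * average (rescale m (eps n)) v x) @[n --> \oo] -->
    \int[mu]_x (h x * v x).
  apply: (@Rdominated_convergence _ _ _ mu _ _ (fun x => C * `|J x ^- 3 * h x|)).
  - move=> n; exact: Int_measurable (Int_average (sr n) th mv vJ1).
  - by move=> x; apply: cvgM; [exact: cvg_cst|exact: cvg_average].
  - exact: IntZ (Int_norm th.2).
  - move=> n x; rewrite !normrM [`|J x ^- 3|]ger0_norm; last first.
      by rewrite invr_ge0 exprn_ge0// japanese2_ge0.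
    by rewrite mulrC mulrA ler_wpM2r.
under eq_fun do rewrite (average_dual (sr _) th mv vJ1).
under eq_fun => n do under eq_Rintegral do rewrite conv_eq0// mul0r.
rewrite (_ : \int[mu]__ 0 = 0); last by rewrite /Rintegral integral0.
by move=> /(cvg_unique (@Rhausdorff R) (cvg_cst 0)) <-.
Qed.

End TestContinuous.

(** Although absent from the conclusion, [m] acts here as the approximate identity. The factor
    [J x ^- 6] makes [h] integrable and turns a bounded continuous [u] into an admissible test
    function. *)
Lemma ae0_schwartz : {ae mu, forall x, h x = 0}.
Proof.
have J6 x : 0 < J x ^+ 6 by rewrite exprn_gt0// japanese2_gt0.
have Ip : Int mu (fun x => J x ^- 6 * h x).
  apply: (Int_le _ (Int_norm th.2)) => [|x].
    apply: measurable_funM; last exact: th.1.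
    by apply: measurable_fun_continuous3; exact: continuous_japanese2V.
  rewrite !normrM ler_wpM2r// !ger0_norm ?invr_ge0 ?exprn_ge0 ?japanese2_ge0//.
  rewrite lef_pV2 ?posrE ?exprn_gt0 ?japanese2_gt0//.
  by rewrite ler_weXn2l// japanese2_ge1.
have : {ae mu, forall x, J x ^- 6 * h x = 0}.
  apply: (ae0_continuous Ip) => u cu u1.
  rewrite -(@Rintegral_continuous_eq0 (fun x => J x ^- 6 * u x)).
  - by apply: eq_Rintegral => x _; rewrite mulrAC mulrC.
  - by move=> x; apply: cvgM; [exact: continuous_japanese2V|exact: cu].
  - by move=> x; rewrite normrM gtr0_norm ?invr_gt0// ler_piMr// invr_ge0 ltW.
move=> [N [mN N0 sN]]; exists N; split=> // x /= hx; apply: sN => /eqP.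
by rewrite mulf_eq0 invr_eq0 gt_eqF//= => /eqP.
Qed.

End TestSchwartz.
End Uniqueness.

(** * Mollification in Sobolev spaces *)

(* Jensen's inequality for the square: expand the integral of
   w (v - c)^2 >= 0, where c is the mean of v. *)
Lemma sqr_Rintegral_le d (T : measurableType d) (R : realType)
    (mu : {measure set T -> \bar R}) (w v : T -> R) :
  (forall x, 0 <= w x) -> \int[mu]_x w x = 1 -> Int mu w ->
  Int mu (fun x => w x * v x) -> Int mu (fun x => w x * v x ^+ 2) ->
  (\int[mu]_x (w x * v x)) ^+ 2 <= \int[mu]_x (w x * v x ^+ 2).
Proof.
move=> w0 w1 Iw Iv Iv2; set c := \int[mu]_x (w x * v x).
have : 0 <= \int[mu]_x (w x * (v x - c) ^+ 2).
  by apply: Rintegral_ge0 => x _; rewrite mulr_ge0// sqr_ge0.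
have -> : \int[mu]_x (w x * (v x - c) ^+ 2) =
    \int[mu]_x (w x * v x ^+ 2 + ((- (2 * c)) * (w x * v x) + c ^+ 2 * w x)).
  by apply: eq_Rintegral => x _; ring.
rewrite RintegralD//; last by apply: IntD; exact: IntZ.
rewrite RintegralD//; [|exact: IntZ|exact: IntZ].
rewrite !RintegralZl// w1 -/c; nra.
Qed.

Section Kernel.
Variable R : realType.
Variable M : R3 R -> R.
Hypotheses (sM : schwartz M) (M_ge0 : forall x, 0 <= M x)
  (M_int : \int[leb3 R]_x M x = 1).
Implicit Types (u : R3 R -> R) (x y z xi : R3 R).
Local Notation mu := (leb3 R).
Local Notation J := (@japanese2 R).

Let n1 : (-1 : R) != 0. Proof. by rewrite oppr_eq0 oner_eq0. Qed.

Lemma translate_Int x : Int mu (fun y => M (x - y)).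
Proof.
have := integrable_affine3 x n1 (schwartz_Int sM).
by under eq_fun do rewrite scaleN1r addrC.
Qed.

Lemma Rintegral_translate x : \int[mu]_y M (x - y) = 1.
Proof.
have := Rintegral_affine3 x n1 (schwartz_Int sM).
rewrite normrN1 expr1n invr1 mul1r M_int => <-.
by apply: eq_Rintegral => y _; rewrite scaleN1r addrC.
Qed.

Lemma Rintegral_translate2 y : \int[mu]_x M (x - y) = 1.
Proof.
have := Rintegral_affine3 (- y) (oner_neq0 R) (schwartz_Int sM).
rewrite normr1 expr1n invr1 mul1r M_int => <-.
by apply: eq_Rintegral => x _; rewrite scale1r.
Qed.

Lemma translate_Int2 y : Int mu (fun x => M (x - y)).
Proof.
have := integrable_affine3 (- y) (oner_neq0 R) (schwartz_Int sM).
by under eq_fun do rewrite scale1r.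
Qed.

Lemma Int_tempered u : Int mu u -> tempered u.
Proof.
move=> Iu; have mu' := Int_measurable Iu; split=> //.
apply: (Int_le _ (Int_norm Iu)) => [|x].
  apply: measurable_funM => //.
  by apply: measurable_fun_continuous3; exact: continuous_japanese2V.
rewrite normrM ler_piMl// ger0_norm ?invr_ge0 ?exprn_ge0 ?japanese2_ge0//.
by rewrite invf_le1 ?exprn_ege1 ?exprn_gt0 ?japanese2_gt0// japanese2_ge1.
Qed.

(** Tonelli's theorem, integrating first in [x], where the kernel has mass 1. *)
Lemma conv_Int1 u : (forall x, 0 <= u x) -> Int mu u -> Int mu (conv M u).
Proof.
move=> u0 Iu; have tu := Int_tempered Iu.
pose K (p : mR3 R * mR3 R) := M ((p.1 : R3 R) - (p.2 : R3 R)) * u p.2.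
have mK : measurable_fun setT K.
  apply: measurable_funM; last exact: measurableT_comp tu.1 measurable_snd.
  exact: (measurableT_comp (schwartz_measurable sM) (measurableT_comp
    (@measurable_sub3 R) (measurable_fun_pair measurable_snd measurable_fst))).
have IK : Int (mu \x mu)%E K.
  apply/integrable21ltyP; first exact/measurable_EFinP.
  rewrite (eq_integral (fun y : mR3 R => (u y)%:E)).
    have /integrableP[_] := Iu; congr (_ < _)%E.
    by apply: eq_integral => y _ /=; rewrite ger0_norm.
  move=> y _ /=.
  have -> : (u y)%:E = (\int[mu]_x (M (x - y) * u y))%:E.
    by rewrite RintegralZr ?Rintegral_translate2 ?mul1r//; exact: translate_Int2.
  rewrite fineK; last first.
    apply: integrable_fin_num => //.
    have := IntZ (u y) (translate_Int2 y); by under eq_fun do rewrite mulrC.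
  by apply: eq_integral => x _; rewrite /K/= ger0_norm// mulr_ge0.
have := integrable_fubini_F IK; congr (_.-integrable _ _).
apply/funext => x; rewrite /fubini_F /= fineK//.
by apply: integrable_fin_num => //; exact: conv_Int.
Qed.

(** For fixed [x], [M (x - y)] is a probability density in [y], so Jensen's inequality bounds the
    square of [conv M u] by [conv M] of [u ^+ 2], which is integrable by [conv_Int1]. *)
Lemma conv_Lfun2 u : u \in Lfun mu 2%:E -> conv M u \in Lfun mu 2%:E.
Proof.
move=> u2; have tu := Lfun2_tempered u2; have /Lfun2P[mu' Iu] := u2.
have mc : measurable_fun [set: mR3 R] (conv M u).
  by apply: measurable_fun_continuous3; exact: conv_continuous.
apply/Lfun2P; split => //.
have u20 x : 0 <= u x ^+ 2 by exact: sqr_ge0.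
apply: (Int_le _ (conv_Int1 u20 Iu)) => [|x]; first exact: measurable_funX.
rewrite ger0_norm ?sqr_ge0//.
apply: sqr_Rintegral_le => //; first exact: Rintegral_translate.
- exact: translate_Int.
- exact: conv_Int.
- exact: conv_Int (Int_tempered Iu).
Qed.

(** Jensen's inequality for the real and the imaginary part separately; the two bounds add up to the
    integral of [M], because the squares of cosine and sine sum to 1. *)
Lemma normc_multiplier_le1 xi : Normc.normc (multiplier M xi) <= 1.
Proof.
rewrite /Normc.normc /multiplier sqrrN.
suff : cos_transform M 0 xi ^+ 2 + cos_transform M (- (pi / 2)) xi ^+ 2 <= 1.
  by move=> /ler_wsqrtr; rewrite sqrtr1.
have IM := schwartz_Int sM.
have I2 t : Int mu (fun z => M z * cos (dot z xi + t) ^+ 2).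
  apply: (Int_le _ (Int_norm IM)) => [|z].
    apply: measurable_funM; first exact: schwartz_measurable.
    apply: measurable_funX; apply: measurable_fun_continuous3.
    exact: continuous_cos_dot.
  by rewrite normrM ler_piMr// normrX exprn_ile1// cos_max.
have H t : cos_transform M t xi ^+ 2 <= \int[mu]_z (M z * cos (dot z xi + t) ^+ 2).
  by apply: sqr_Rintegral_le => //; exact: cos_transform_Int.
rewrite (le_trans (lerD (H _) (H _)))// -RintegralD//.
rewrite -[leRHS]M_int; apply: le_Rintegral => //; first exact: IntD.
by move=> z _; rewrite addr0 cosBpihalf -mulrDr cos2Dsin2 mulr1.
Qed.

End Kernel.

Lemma Lfun2B d (T : measurableType d) (R : realType)
    (mu : {measure set T -> \bar R}) (u v : T -> R) :
  u \in Lfun mu 2%:E -> v \in Lfun mu 2%:E ->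
  (fun x => u x - v x) \in Lfun mu 2%:E.
Proof.
move=> u2 /Lfun2P[mv Iv].
have N2 : (fun x => - v x) \in Lfun mu 2%:E.
  apply/Lfun2P; split; first exact: measurable_funN.
  by under eq_fun do rewrite sqrrN.
exact: Lfun2D u2 N2.
Qed.

(** * Weighted L^2 norms on the Fourier side *)

Section WeightedNorm.
Variable R : realType.
Implicit Types (g : R3 R -> R[i]) (x y xi : R3 R) (s : R).
Local Notation mu := (leb3 R).
Local Notation J := (@japanese2 R).
Local Notation normc := (@Normc.normc R).

Definition weighted s g xi : R := J xi `^ (s / 2) * normc (g xi).

Lemma weighted_normE s g : weighted_norm s g =
  ((\int[mu]_xi (weighted s g xi ^+ 2)%:E) `^ 2^-1)%E.
Proof. exact: (Lnorm2E mu (weighted s g)). Qed.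

Lemma normcE (z : R[i]) :
  normc z = Num.sqrt (complex.Re z ^+ 2 + complex.Im z ^+ 2).
Proof. by case: z. Qed.

Lemma normc_ge0 (z : R[i]) : 0 <= normc z.
Proof. by rewrite normcE sqrtr_ge0. Qed.

Lemma weighted_ge0 s g xi : 0 <= weighted s g xi.
Proof. by rewrite mulr_ge0 ?powR_ge0 ?normc_ge0. Qed.

Lemma measurable_weighted s g : cL2 g -> measurable_fun [set: mR3 R] (weighted s g).
Proof.
move=> [/Lfun2P[ma _] /Lfun2P[mb _]]; apply: measurable_funM.
  by apply: (measurableT_comp (@measurable_powR R (s / 2))); exact: (@measurable_japanese2 R).
have -> : (fun xi => normc (g xi)) =
    (fun xi => Num.sqrt (reF g xi ^+ 2 + imF g xi ^+ 2)).
  by apply/funext => xi; rewrite normcE.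
apply: (@measurableT_comp _ _ _ _ _ _ (@Num.sqrt R)).
  by apply: continuous_measurable_fun; exact: sqrt_continuous.
by apply: measurable_funD; exact: measurable_funX.
Qed.

(** Stated in the extended reals, so that it also yields finiteness of the left norm from that of
    the right one. *)
Lemma weighted_norm_le s t f g (C : R) : 0 <= C -> cL2 f -> cL2 g ->
  (forall xi, weighted s f xi <= C * weighted t g xi) ->
  (weighted_norm s f <= C%:E * weighted_norm t g)%E.
Proof.
move=> C0 mf mg fg; rewrite !weighted_normE.
have -> : (C%:E = (C ^+ 2)%:E `^ 2^-1)%E.
  by rewrite poweR_EFin powR12_sqrt ?sqr_ge0// sqrtr_sqr ger0_norm.
rewrite -poweRM ?lee_fin ?sqr_ge0//; last first.
  by apply: integral_ge0 => xi _; rewrite lee_fin sqr_ge0.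
rewrite -ge0_integralZl_EFin ?sqr_ge0//; last 2 first.
- by move=> xi _; rewrite lee_fin sqr_ge0.
- by apply/measurable_EFinP; apply: measurable_funX; exact: measurable_weighted.
rewrite gt0_ler_poweR// ?in_itv/= ?leey ?andbT.
- by apply: integral_ge0 => xi _; rewrite lee_fin sqr_ge0.
- by apply: integral_ge0 => xi _; rewrite mule_ge0 ?lee_fin ?sqr_ge0.
apply: ge0_le_integral => //.
- by move=> xi _; rewrite lee_fin sqr_ge0.
- by apply/measurable_EFinP; apply: measurable_funX; exact: measurable_weighted.
- apply/measurable_EFinP; apply: measurable_funM => //.
  by apply: measurable_funX; exact: measurable_weighted.
- move=> xi _; rewrite -EFinM lee_fin -exprMn lerXn2r ?nnegrE ?weighted_ge0//.
  by rewrite mulr_ge0// weighted_ge0.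
Qed.

Lemma weighted_norm_ae s f g : cL2 f -> cL2 g ->
  {ae mu, forall xi, f xi = g xi} -> weighted_norm s f = weighted_norm s g.
Proof.
move=> f2 g2 fg; rewrite !weighted_normE; congr (_ `^ _)%E.
have mw h : cL2 h -> measurable_fun [set: mR3 R] (fun xi => (weighted s h xi ^+ 2)%:E).
  by move=> h2; apply/measurable_EFinP; apply: measurable_funX; exact: measurable_weighted.
apply: ae_eq_integral => //; try exact: mw.
case: fg => N [mN N0 sN]; exists N; split=> // xi /= H; apply: sN => /= E.
by apply: H => _; rewrite /weighted E.
Qed.

Lemma weighted_Int s g : cL2 g -> (weighted_norm s g < +oo)%E ->
  Int mu (fun xi => weighted s g xi ^+ 2).
Proof.
move=> g2; rewrite weighted_normE => H; apply/integrableP; split.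
  by apply/measurable_EFinP; apply: measurable_funX; exact: measurable_weighted.
under eq_integral do rewrite /= ger0_norm ?sqr_ge0//.
by rewrite ltey; apply/eqP => E; move: H; rewrite E poweRyr.
Qed.

Lemma weighted_normR s g : Int mu (fun xi => weighted s g xi ^+ 2) ->
  weighted_norm s g = (Num.sqrt (\int[mu]_xi (weighted s g xi ^+ 2)))%:E.
Proof.
move=> Iw; rewrite weighted_normE -[X in (X `^ _)%E]fineK; last exact: integrable_fin_num.
rewrite poweR_EFin powR12_sqrt//.
by apply: Rintegral_ge0 => xi _; exact: sqr_ge0.
Qed.

End WeightedNorm.

(** * Independence of the Sobolev norm from the chosen Fourier transform *)

Section FourierUniqueness.
Variable R : realType.
Variable m : R3 R -> R.
Hypotheses (sm : schwartz m) (m1 : \int[leb3 R]_x m x = 1).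
Implicit Types (f g phi psi : R3 R -> R[i]).
Local Notation mu := (leb3 R).

Lemma is_fourier_ae phi f g : is_fourier phi f -> is_fourier phi g ->
  {ae mu, forall xi, f xi = g xi}.
Proof.
move=> [[fa fb] Hf] [[ga gb] Hg].
have key F : schwartz F ->
    \int[mu]_x (reF f x * F x) = \int[mu]_x (reF g x * F x) /\
    \int[mu]_x (imF f x * F x) = \int[mu]_x (imF g x * F x).
  (* A real-valued test function separates the real and imaginary parts of the pairing. *)
  move=> sF; pose psi x : R[i] := (F x)%:C%C.
  have spsi : cschwartz psi.
    split; first exact: sF.
    by have := schwartzZ 0 sF; under eq_fun do rewrite mul0r.
  have : cintegral (fun xi => f xi * psi xi) = cintegral (fun xi => g xi * psi xi).
    by rewrite Hf// Hg.
  have E h : cintegral (fun xi => h xi * psi xi) =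
      ((\int[mu]_x (reF h x * F x)) +i* (\int[mu]_x (imF h x * F x)))%C.
    congr (_ +i* _)%C; apply: eq_Rintegral => x _.
      by rewrite [LHS]ReM /= mulr0 subr0.
    by rewrite [LHS]ImM /= mulr0 add0r.
  by rewrite !E => -[].
have diff (u v : R3 R -> R) : u \in Lfun mu 2%:E -> v \in Lfun mu 2%:E ->
    (forall F, schwartz F -> \int[mu]_x (u x * F x) = \int[mu]_x (v x * F x)) ->
    {ae mu, forall x, u x - v x = 0}.
  move=> u2 v2 H; have w2 := Lfun2B u2 v2.
  apply: (ae0_schwartz sm m1 (Lfun2_tempered w2)) => F sF.
  have F2 := schwartz_Lfun2 sF.
  under eq_Rintegral do rewrite mulrBl.
  by rewrite RintegralB ?H ?subrr//; exact: Lfun2M_Int.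
have [N1 [mN1 N10 s1]] := diff _ _ fa ga (fun F sF => (key F sF).1).
have [N2 [mN2 N20 s2]] := diff _ _ fb gb (fun F sF => (key F sF).2).
exists (N1 `|` N2); split.
- exact: measurableU.
- apply/eqP; rewrite eq_le measure_ge0 andbT.
  apply: (le_trans (measureU2 mu mN1 mN2)).
  by rewrite [X in (X + _)%E]N10 [X in (_ + X)%E]N20 adde0.
move=> x /= fgx; apply: contrapT => /not_orP[n1 n2]; apply: fgx.
apply: complex_eq; apply/eqP; rewrite -subr_eq0; apply/eqP; apply: contrapT => H.
  by apply: n1; exact: s1.
by apply: n2; exact: s2.
Qed.

(** Frees the norm from the choice made in [fourier]: the chosen transform and [g] agree almost
    everywhere. *)
Lemma sobolev_normE s phi g : is_fourier phi g ->
  sobolev_norm s phi = weighted_norm s g.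
Proof.
move=> Hg; have Hf : is_fourier phi (fourier phi).
  by rewrite /fourier; case: xgetP => [h -> //|/(_ g)].
apply: weighted_norm_ae; [by case: Hf|by case: Hg|exact: is_fourier_ae Hf Hg].
Qed.

End FourierUniqueness.

Section FourierDifference.
Variable R : realType.
Implicit Types (f g h phi psi : R3 R -> R[i]).
Local Notation mu := (leb3 R).

Lemma ReB (a b : R[i]) : complex.Re (a - b) = complex.Re a - complex.Re b.
Proof. by case: a b => [? ?] []. Qed.

Lemma ImB (a b : R[i]) : complex.Im (a - b) = complex.Im a - complex.Im b.
Proof. by case: a b => [? ?] []. Qed.

Lemma cL2B f g : cL2 f -> cL2 g -> cL2 (fun x => f x - g x).
Proof.
move=> [fa fb] [ga gb]; split.
  rewrite (_ : reF _ = fun x => reF f x - reF g x); first exact: Lfun2B.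
  by apply/funext => x; rewrite /reF ReB.
rewrite (_ : imF _ = fun x => imF f x - imF g x); first exact: Lfun2B.
by apply/funext => x; rewrite /imF ImB.
Qed.

Lemma cintegralMB f g h : cL2 f -> cL2 g -> cL2 h ->
  cintegral (fun x => (f x - g x) * h x) =
  cintegral (fun x => f x * h x) - cintegral (fun x => g x * h x).
Proof.
have Ire u v : cL2 u -> cL2 v -> Int mu (reF (fun x => u x * v x)).
  move=> [ua ub] [va vb].
  have := IntB (Lfun2M_Int ua va) (Lfun2M_Int ub vb).
  by congr (_.-integrable _ _); apply/funext => x /=; rewrite [in RHS]/reF ReM.
have Iim u v : cL2 u -> cL2 v -> Int mu (imF (fun x => u x * v x)).
  move=> [ua ub] [va vb].
  have := IntD (Lfun2M_Int ua vb) (Lfun2M_Int ub va).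
  by congr (_.-integrable _ _); apply/funext => x /=; rewrite [in RHS]/imF ImM.
move=> f2 g2 h2; apply: complex_eq; rewrite ?ReB ?ImB /cintegral /=.
  rewrite -RintegralB//; [|exact: Ire|exact: Ire].
  by apply: eq_Rintegral => x _; rewrite /reF mulrBl ReB.
rewrite -RintegralB//; [|exact: Iim|exact: Iim].
by apply: eq_Rintegral => x _; rewrite /imF mulrBl ImB.
Qed.

Lemma is_fourierB phi1 phi2 g1 g2 : cL2 phi1 -> cL2 phi2 ->
  is_fourier phi1 g1 -> is_fourier phi2 g2 ->
  is_fourier (phi1 \- phi2) (fun xi => g1 xi - g2 xi).
Proof.
move=> p1 p2 [g12 H1] [g22 H2]; split; first exact: cL2B.
move=> psi spsi; have F2 := fourier_integral_cL2 spsi.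
have psi2 : cL2 psi by case: spsi => sa sb; split; exact: schwartz_Lfun2.
by rewrite cintegralMB// H1// H2// -cintegralMB.
Qed.

End FourierDifference.

(** * The estimates for the rescaled kernel *)

Section Mollifier.
Variable R : realType.
Variable m : R3 R -> R.
Hypotheses (sm : schwartz m) (m_ge0 : forall x, 0 <= m x)
  (m1 : \int[leb3 R]_x m x = 1).
Implicit Types (g phi : R3 R -> R[i]) (xi : R3 R) (s t eps : R).
Local Notation mu := (leb3 R).
Local Notation J := (@japanese2 R).
Local Notation normc := (@Normc.normc R).

Lemma rescale_ge0 eps x : 0 < eps -> 0 <= rescale m eps x.
Proof. by move=> e0; rewrite mulr_ge0// invr_ge0 exprn_ge0// ltW. Qed.

Lemma Rintegral_rescale eps : 0 < eps -> \int[mu]_x rescale m eps x = 1.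
Proof.
move=> e0; rewrite -m1.
have := @average_rescale R m eps (fun=> 1) 0 e0.
rewrite /average; under eq_Rintegral do rewrite mulr1; under eq_fun do rewrite mulr1.
by apply; exact: schwartz_Int.
Qed.

Lemma cos_transform_rescale eps t xi : 0 < eps ->
  cos_transform (rescale m eps) t xi = cos_transform m t (eps *: xi).
Proof.
move=> e0; have := @average_rescale R m eps (fun z => cos (dot z xi + t)) 0 e0.
have E w : dot (0 + eps *: w) xi = dot w (eps *: xi).
  by rewrite /dot/= /GRing.scale/=; ring.
under eq_fun do rewrite E.
move=> /(_ (cos_transform_Int t (eps *: xi) (schwartz_Int sm))).
by rewrite /average; under eq_Rintegral do rewrite add0r.
Qed.

Lemma multiplier_rescale eps xi : 0 < eps ->
  multiplier (rescale m eps) xi = multiplier m (eps *: xi).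
Proof. by move=> e0; rewrite /multiplier !cos_transform_rescale. Qed.

Lemma cconv_cL2 M phi : schwartz M -> (forall x, 0 <= M x) ->
  \int[mu]_x M x = 1 -> cL2 phi -> cL2 (cconv M phi).
Proof.
by move=> sM M0 M1 [pa pb]; rewrite cconvE; split; exact: conv_Lfun2.
Qed.

Lemma cL2_tempered phi : cL2 phi -> tempered (reF phi) /\ tempered (imF phi).
Proof. by move=> [pa pb]; split; exact: Lfun2_tempered. Qed.

(** The common source of boundedness ([t = s], [C = 1]) and of smoothing ([t = s + 2k]): each
    reduces to a pointwise comparison of the multiplier with two weights. *)
Lemma sobolev_cconv M s t (C : R) phi : schwartz M -> (forall x, 0 <= M x) ->
  \int[mu]_x M x = 1 -> 0 <= C ->
  (forall xi, J xi `^ (t / 2) * normc (multiplier M xi) <= C * J xi `^ (s / 2)) ->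
  sobolev s phi -> sobolev t (cconv M phi) /\
    (sobolev_norm t (cconv M phi) <= C%:E * sobolev_norm s phi)%E.
Proof.
move=> sM M0 M1 C0 MC [p2 [g Fg goo]].
have [ta tb] := cL2_tempered p2.
have FM := is_fourier_cconv sM ta tb Fg.
have g2 : cL2 g by case: Fg.
have le : (weighted_norm t (fun xi => multiplier M xi * g xi)%R <=
    C%:E * weighted_norm s g)%E.
  apply: weighted_norm_le => //; first exact: multiplier_cL2.
  move=> xi; rewrite /weighted Normc.normcM !mulrA ler_wpM2r//.
  exact: normc_ge0.
split; last by rewrite (sobolev_normE sm m1 _ FM) (sobolev_normE sm m1 _ Fg).
split; first exact: cconv_cL2.
exists (fun xi => multiplier M xi * g xi) => //.
by apply: le_lt_trans le _; rewrite lte_mul_pinfty.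
Qed.

Lemma normc_le (z : R[i]) : normc z <= `|complex.Re z| + `|complex.Im z|.
Proof.
rewrite normcE -[leRHS]ger0_norm ?addr_ge0// -sqrtr_sqr ler_wsqrtr//.
rewrite -[complex.Re z ^+ 2]real_normK ?num_real// -[complex.Im z ^+ 2]real_normK ?num_real//.
have := normr_ge0 (complex.Re z); have := normr_ge0 (complex.Im z); nra.
Qed.

Lemma multiplier_decay k : exists A : R, forall xi,
  J xi ^+ k * normc (multiplier m xi) <= A.
Proof.
have [A HA] := cos_transform_decay 0 sm k.
have [B HB] := cos_transform_decay (- (pi / 2)) sm k.
exists (A + B) => xi.
have J0 : 0 <= J xi ^+ k by rewrite exprn_ge0// japanese2_ge0.
rewrite (le_trans (ler_wpM2l J0 (normc_le _)))// mulrDr /= normrN.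
by rewrite lerD.
Qed.

Lemma japanese2_powRD s k xi :
  J xi `^ ((s + (2 * k)%:R) / 2) = J xi `^ (s / 2) * J xi ^+ k.
Proof.
rewrite mulrDl natrM mulrAC mulfV// mul1r powRD; last first.
  by apply/implyP => _; rewrite gt_eqF// japanese2_gt0.
by rewrite powR_mulrn// japanese2_ge0.
Qed.

Lemma multiplier_rescale_decay k (eps0 : R) : 0 < eps0 -> exists2 C : R, 0 < C &
  forall eps xi, 0 < eps <= eps0 ->
    J xi ^+ k * normc (multiplier (rescale m eps) xi) <= C * eps ^- (2 * k).
Proof.
move=> e00; have [A HA] := multiplier_decay k.
have A0 : 0 <= A.
  apply: le_trans (HA 0); rewrite mulr_ge0 ?normc_ge0// exprn_ge0//.
  exact: japanese2_ge0.
(* The first term is the bound itself: [A] from the decay of the unscaled multiplier, the power from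
   [JJ]. The summand 1 ensures positivity. *)
exists ((1 + eps0 ^+ 2) ^+ k * A + 1).
  by rewrite ltr_wpDl// mulr_ge0// exprn_ge0// addr_ge0// sqr_ge0.
move=> eps xi /andP[e0 ee0]; rewrite multiplier_rescale//.
have e20 : 0 <= eps ^- 2 by rewrite invr_ge0 sqr_ge0.
(* Multiplied by eps^2, the left side is eps^2 + |eps xi|^2, at most (1 + eps0^2)(1 + |eps
   xi|^2). *)
have JJ : J xi <= eps ^- 2 * (1 + eps0 ^+ 2) * J (eps *: xi).
  rewrite -mulrA ler_pdivlMl ?exprn_gt0//.
  rewrite /japanese2.
  have -> : dot (eps *: xi) (eps *: xi) = eps ^+ 2 * dot xi xi.
    by rewrite /dot/= /GRing.scale/=; ring.
  have d0 := dot_ge0 xi; set d := dot xi xi in d0 *.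
  have e2 : eps ^+ 2 <= eps0 ^+ 2 by apply: lerXn2r => //; rewrite nnegrE ltW.
  have h1 : 0 <= eps ^+ 2 * d by rewrite mulr_ge0 ?sqr_ge0.
  have h2 : 0 <= eps0 ^+ 2 * (eps ^+ 2 * d) by rewrite mulr_ge0 ?sqr_ge0.
  by move: e2 h1 h2; set a := eps ^+ 2; set b := eps0 ^+ 2 => e2 h1 h2; nra.
have JJk : J xi ^+ k <= eps ^- (2 * k) * (1 + eps0 ^+ 2) ^+ k * J (eps *: xi) ^+ k.
  rewrite exprM -exprVn -!exprMn lerXn2r ?nnegrE ?japanese2_ge0//.
  by rewrite !mulr_ge0 ?japanese2_ge0// addr_ge0 ?sqr_ge0.
rewrite (le_trans (ler_wpM2r (normc_ge0 _) JJk))// -mulrA.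
rewrite [leRHS]mulrC mulrDr mulr1 -mulrA ler_wpDr ?invr_ge0 ?exprn_ge0 ?(ltW e0)//.
rewrite ler_wpM2l ?invr_ge0 ?exprn_ge0 ?(ltW e0)// -mulrA ler_wpM2l//.
by rewrite exprn_ge0// addr_ge0 ?sqr_ge0.
Qed.

Lemma sobolev_mollify s phi eps : 0 < eps -> sobolev s phi ->
  sobolev s (mollify m eps phi) /\
  (sobolev_norm s (mollify m eps phi) <= sobolev_norm s phi)%E.
Proof.
move=> e0 sphi; rewrite -[leRHS]mul1e.
apply: sobolev_cconv => //; first exact: schwartz_rescale.
- by move=> x; exact: rescale_ge0.
- exact: Rintegral_rescale.
- move=> xi; rewrite mul1r ler_piMr ?powR_ge0//.
  apply: normc_multiplier_le1; first exact: schwartz_rescale.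
    by move=> x; exact: rescale_ge0.
  exact: Rintegral_rescale.
Qed.

Lemma sobolev_mollify_smoothing k (eps0 : R) : 0 < eps0 -> exists2 C : R, 0 < C &
  forall s phi eps, sobolev s phi -> 0 < eps <= eps0 ->
    sobolev (s + (2 * k)%:R) (mollify m eps phi) /\
    (sobolev_norm (s + (2 * k)%:R) (mollify m eps phi) <=
      (C * eps ^- (2 * k))%:E * sobolev_norm s phi)%E.
Proof.
move=> /(multiplier_rescale_decay k)[C C0 HC]; exists C => // s phi eps sphi ee.
have /andP[e0 _] := ee.
apply: sobolev_cconv => //; first exact: schwartz_rescale.
- by move=> x; exact: rescale_ge0.
- exact: Rintegral_rescale.
- by rewrite mulr_ge0 ?invr_ge0 ?exprn_ge0// ltW.
- move=> xi; rewrite japanese2_powRD -mulrA [leRHS]mulrC ler_wpM2l ?powR_ge0//.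
  exact: HC.
Qed.

Lemma csmooth_mollify s phi eps : 0 < eps -> sobolev s phi ->
  csmooth (mollify m eps phi).
Proof.
move=> e0 [/cL2_tempered[ta tb] _].
have -> : mollify m eps phi = cconv (rescale m eps) phi by [].
by rewrite cconvE; split; apply: conv_smooth => //; exact: schwartz_rescale.
Qed.

Lemma multiplier0 : multiplier m 0 = 1.
Proof.
have d0 z : dot z (0 : R3 R) = 0 by rewrite /dot/= !mulr0 !addr0.
apply: complex_eq; rewrite /= /cos_transform.
  rewrite -[RHS]m1; apply: eq_Rintegral => z _.
  by rewrite d0 addr0 cos0 mulr1.
under eq_Rintegral do rewrite d0 add0r cosN cos_pihalf mulr0.
by rewrite /Rintegral integral0 oppr0.
Qed.

Lemma cvg_multiplier xi (u : nat -> R) : u n @[n --> \oo] --> (0 : R) ->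
  normc (multiplier m (u n *: xi) - 1) @[n --> \oo] --> (0 : R).
Proof.
move=> u0; have uxi : u n *: xi @[n --> \oo] --> (0 : R3 R).
  by rewrite -(scale0r xi); apply: cvgZr_tmp.
have cc t : cos_transform m t (u n *: xi) @[n --> \oo] --> cos_transform m t 0.
  exact: (@continuous_cvg _ _ _ _ _ _ (cos_transform m t) 0
    (@cos_transform_continuous _ _ t (schwartz_moments sm) 0) uxi).
have M0 : multiplier m 0 = 1 := multiplier0.
have c0 : cos_transform m 0 0 = 1 by have := congr1 (@complex.Re R) M0.
have s0 : - cos_transform m (- (pi / 2)) 0 = 0.
  by have := congr1 (@complex.Im R) M0.
have -> : (fun n => normc (multiplier m (u n *: xi) - 1)) = (fun n =>
    Num.sqrt ((cos_transform m 0 (u n *: xi) - 1) ^+ 2 +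
              (- cos_transform m (- (pi / 2)) (u n *: xi)) ^+ 2)).
  by apply/funext => n; rewrite normcE ReB ImB /= subr0.
have sq (v : nat -> R) (l : R) : v n @[n --> \oo] --> l ->
    v n ^+ 2 @[n --> \oo] --> l ^+ 2.
  move=> vl; exact: (@continuous_cvg _ _ _ _ _ _ (fun z : R => z ^+ 2) l
    (@exprn_continuous _ 2 l) vl).
have : Num.sqrt ((cos_transform m 0 (u n *: xi) - 1) ^+ 2 +
      (- cos_transform m (- (pi / 2)) (u n *: xi)) ^+ 2) @[n --> \oo] -->
    Num.sqrt ((cos_transform m 0 0 - 1) ^+ 2 +
      (- cos_transform m (- (pi / 2)) 0) ^+ 2).
  apply: (@continuous_cvg _ _ _ _ _ _ (@Num.sqrt R)); first exact: sqrt_continuous.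
  apply: cvgD; apply: sq; first by apply: cvgB; [exact: cc|exact: cvg_cst].
  by apply: cvgN; exact: cc.
by rewrite c0 s0 subrr expr0n addr0 sqrtr0.
Qed.

Lemma cvg_weighted_mollify s g : cL2 g -> (weighted_norm s g < +oo)%E ->
  weighted_norm s (fun xi => (multiplier m (eps *: xi) - 1) * g xi)%R
    @[eps --> 0^'+] --> 0%E.
Proof.
move=> g2 goo; have Iw := weighted_Int g2 goo.
pose h eps xi := (multiplier m (eps *: xi) - 1) * g xi.
have wh eps xi : weighted s (h eps) xi =
    normc (multiplier m (eps *: xi) - 1) * weighted s g xi.
  by rewrite /weighted /h Normc.normcM mulrCA.
have n2 eps xi : normc (multiplier m (eps *: xi) - 1) <= 2.
  have n1 := normc_multiplier_le1 sm m_ge0 m1 (eps *: xi).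
  rewrite (le_trans (le_normcD _ _))// normcN Normc.normc1; lra.
have h2 eps : 0 < eps -> cL2 (h eps).
  move=> e0; have := cL2B (multiplier_cL2 (schwartz_rescale e0 sm) g2) g2.
  congr cL2; apply/funext => xi.
  by rewrite multiplier_rescale// /h mulrBl mul1r.
(* The 4 is the square of the bound 2 on |mhat - 1|, and the right side is integrable because [g]
   has finite weighted norm. *)
have dom eps xi : `|weighted s (h eps) xi ^+ 2| <= 4 * weighted s g xi ^+ 2.
  rewrite normrX wh normrM exprMn [X in _ * X ^+ 2]ger0_norm ?weighted_ge0//.
  rewrite ler_wpM2r ?sqr_ge0// ger0_norm ?normc_ge0//.
  have -> : 4 = 2 ^+ 2 :> R by rewrite expr2 -natrM.
  by apply: lerXn2r; rewrite ?nnegrE ?normc_ge0.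
have mh eps : 0 < eps -> measurable_fun [set: mR3 R] (fun xi => weighted s (h eps) xi ^+ 2).
  by move=> e0; apply: measurable_funX; apply: measurable_weighted; exact: h2.
have Ih eps : 0 < eps -> Int mu (fun xi => weighted s (h eps) xi ^+ 2).
  by move=> e0; exact: (Int_le (mh _ e0) (IntZ 4 Iw) (dom eps)).
pose F eps := Num.sqrt (\int[mu]_xi (weighted s (h eps) xi ^+ 2)).
have F0 : F eps @[eps --> (0 : R)^'+] --> (0 : R).
  (* The one-sided limit is tested on sequences of positive numbers tending to 0, as dominated
     convergence requires. *)
  apply/cvg_at_rightP => u [u_gt0 u0].
  have : \int[mu]_xi (weighted s (h (u n)) xi ^+ 2) @[n --> \oo] -->
      \int[mu]_(xi in setT) (0 : R).
    apply: (@Rdominated_convergence _ _ _ mu _ _ (fun xi => 4 * weighted s g xi ^+ 2)) => //.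
    - by move=> n; exact: mh.
    - move=> xi; have H := cvg_multiplier xi u0.
      have : (normc (multiplier m (u n *: (xi : R3 R)) - 1) * weighted s g xi) ^+ 2
          @[n --> \oo] --> (0 * weighted s g xi) ^+ 2.
        apply: (@continuous_cvg _ _ _ _ _ _ (fun z : R => z ^+ 2)); first exact: exprn_continuous.
        by apply: cvgM; [exact: H|exact: cvg_cst].
      by rewrite mul0r expr0n; under eq_fun do rewrite -wh.
    - exact: IntZ.
  rewrite [X in _ --> X -> _](_ : _ = 0); last by rewrite /Rintegral integral0.
  move=> H0.
  rewrite -[X in _ --> X]sqrtr0.
  by apply: (@continuous_cvg _ _ _ _ _ _ (@Num.sqrt R)); first exact: sqrt_continuous.
have : (F eps)%:E @[eps --> (0 : R)^'+] --> 0%E.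
  by apply: cvg_EFin; [near=> e|exact: F0].
(* The real-valued [F eps] is identified with the norm through [Ih], hence for positive [eps]; the
   filter at the right of 0 sees only those. *)
apply: cvg_trans; apply: near_eq_cvg; near=> eps.
by rewrite weighted_normR//; apply: Ih; near: eps; exact: nbhs_right_gt.
Unshelve. all: by end_near.
Qed.

Lemma cvg_sobolev_mollify s phi : sobolev s phi ->
  sobolev_norm s (mollify m eps phi \- phi) @[eps --> 0^'+] --> 0%E.
Proof.
move=> [p2 [g Fg goo]]; have [g2 _] := Fg; have [ta tb] := cL2_tempered p2.
have := cvg_weighted_mollify g2 goo; apply: cvg_trans.
apply: near_eq_cvg; near=> eps.
have e0 : 0 < eps by near: eps; exact: nbhs_right_gt.
have sM := schwartz_rescale e0 sm.
have M2 : cL2 (mollify m eps phi).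
  apply: cconv_cL2 => //; first by move=> x; exact: rescale_ge0.
  exact: Rintegral_rescale.
have FM : is_fourier (mollify m eps phi) _ := is_fourier_cconv sM ta tb Fg.
rewrite (sobolev_normE sm m1 _ (is_fourierB M2 p2 FM Fg)).
congr weighted_norm; apply/funext => xi.
by rewrite multiplier_rescale// mulrBl mul1r.
Unshelve. all: by end_near.
Qed.

End Mollifier.

Theorem lemma3p2 (R : realType) (m : R3 R -> R)
    (m_Cc : smooth_compact_support m)
    (m_ge0 : forall x, 0 <= m x)
    (m_int : (\int[leb3 R]_x (m x)%:E = 1)%E) :
  [/\ (* boundedness *)
      forall (s : R) (phi : R3 R -> R[i]) (eps : R),
        0 <= s -> sobolev s phi -> 0 < eps ->
        sobolev s (mollify m eps phi) /\
        (sobolev_norm s (mollify m eps phi) <= sobolev_norm s phi)%E,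
      (* approximation *)
      forall (s : R) (phi : R3 R -> R[i]),
        0 <= s -> sobolev s phi ->
        sobolev_norm s (mollify m eps phi \- phi) @[eps --> 0^'+] --> 0%E,
      (* smoothing: eps may range over any bounded interval ]0, eps0] *)
      forall (k : nat) (eps0 : R), 0 < eps0 ->
        exists2 C : R, 0 < C &
          forall (s : R) (phi : R3 R -> R[i]) (eps : R),
            0 <= s -> sobolev s phi -> 0 < eps <= eps0 ->
            sobolev (s + (2 * k)%:R) (mollify m eps phi) /\
            (sobolev_norm (s + (2 * k)%:R) (mollify m eps phi) <=
              (C * eps ^- (2 * k))%:E * sobolev_norm s phi)%E
    & (* regularity *)
      forall (s : R) (phi : R3 R -> R[i]) (eps : R),
        0 <= s -> sobolev s phi -> 0 < eps ->
        csmooth (mollify m eps phi)].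
Proof.
have sm := Cc_schwartz m_Cc.
have m1 : \int[leb3 R]_x m x = 1 by rewrite /Rintegral m_int.
split.
- by move=> s phi eps _ sphi e0; exact: sobolev_mollify.
- by move=> s phi _ sphi; exact: cvg_sobolev_mollify.
- move=> k eps0 /(sobolev_mollify_smoothing sm m_ge0 m1 k)[C C0 HC].
  by exists C => // s phi eps _; exact: HC.
- by move=> s phi eps _ sphi e0; exact: csmooth_mollify sphi.
Qed.
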